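(* Let $\mathbb{F}_q$ be a finite field of characteristic at least $5$, let $\mathcal{M}^*(\mathbb{F}_q)$ be the set of solutions $(x,y,z)\in\mathbb{F}_q^3\setminus\{(0,0,0)\}$ of $X^2+Y^2+Z^2=3XYZ$, and let $\overline{\mathcal{M}}(\mathbb{F}_q)$ be the undirected graph with vertex set $\mathcal{M}^*(\mathbb{F}_q)$ and edges $[P,\rho_i(P)]$ for $P\in\mathcal{M}^*(\mathbb{F}_q)$, $i=1,2,3$. Write $\mathsf{PATH}(q)$ for the time to find a path between two given points of $\overline{\mathcal{M}}(\mathbb{F}_q)$, $\mathsf{DLP}(q)$ for the time to solve the discrete logarithm problem in $\mathbb{F}_q^*$, $\mathsf{FACTOR}(N)$ for the time to factor an integer $N$, and $\mathsf{NEGLIGIBLE}(q)$ for tasks taking negligible (polylogarithmic in $q$) time, for example taking square roots in $\mathbb{F}_q$, or iterations performed $(q-1)/\varphi(q-1)\le 2\log\log q$ times. Assume Heuristic A and Heuristic B (stated in the context) are valid. Then, with high probability, one can find a path between two given points of $\overline{\mathcal{M}}(\mathbb{F}_q)$ (expressed as a word in $\rho_1,\rho_2,\rho_3$ applied to the first point yielding the second) in time $$\mathsf{PATH}(q)\le \mathsf{FACTOR}(q-1)+3\cdot\mathsf{DLP}(q)+\mathsf{NEGLIGIBLE}(q).$$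
   Context: The rotations $\rho_1,\rho_2,\rho_3$ of the Markoff surface $\mathcal{M}: X^2+Y^2+Z^2=3XYZ$ are $\rho_1(x,y,z)=(x,z,3xz-y)$, $\rho_2(x,y,z)=(3xy-z,y,x)$, $\rho_3(x,y,z)=(y,3yz-x,z)$. An element $t\in\mathbb{F}_q^*$ is called maximally hyperbolic if the polynomial $T^2-3tT+1$ has a root $\lambda\in\mathbb{F}_q$ that generates the cyclic group $\mathbb{F}_q^*$ (equivalently, $t=\frac13(\lambda+\lambda^{-1})$ for a generator $\lambda$ of $\mathbb{F}_q^*$). $\varphi$ denotes Euler's function. Heuristic A: for $(x_0,y_0,z_0)\in\mathcal{M}(\mathbb{F}_q)$, if $i_1,\dots,i_n\in\{1,3\}$ are chosen at random and $(x_n,y_n,z_n)=\rho_{i_n}\circ\cdots\circ\rho_{i_1}(x_0,y_0,z_0)$, then the probability that $y_n$ is maximally hyperbolic is approximately $\frac12\cdot\frac{\varphi(q-1)}{q-1}$ (and similarly with the roles of coordinates/rotations permuted as needed). Heuristic B: with $F(X,Y,Z)=X^2+Y^2+Z^2-3XYZ$ and $a,b\in\mathbb{F}_q^*$, let $\mathcal{C}_{a,b}\subset\mathbb{A}^3$ be the curve $F(X,a,Z)=F(X,Y,b)=0$; then for random $t\in\mathbb{F}_q^*$, the probability that $t$ is maximally hyperbolic and is the $x$-coordinate of a point of $\mathcal{C}_{a,b}(\mathbb{F}_q)$ is approximately $\frac18\cdot\frac{\varphi(q-1)}{q}$. *)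

(* Defs.v *)
From HB Require Import structures.
From mathcomp Require Import all_boot all_order all_fingroup all_algebra.
From mathcomp Require Import cyclic.

Set Implicit Arguments.
Unset Strict Implicit.
Unset Printing Implicit Defensive.

Import Order.TTheory GRing.Theory Num.Theory.
Local Open Scope ring_scope.

(** * The Markoff graph over a finite field *)

Definition point (F : finFieldType) : Type := (F * F * F)%type.

Definition markoffF (F : finFieldType) (x y z : F) : F :=
  x ^+ 2 + y ^+ 2 + z ^+ 2 - 3 * x * y * z.

Definition Mstar (F : finFieldType) (P : point F) : bool :=
  let: (x, y, z) := P in
  ((x, y, z) != (0, 0, 0)) &&
  (x ^+ 2 + y ^+ 2 + z ^+ 2 == 3 * x * y * z).

(* Rotations and coordinates are numbered from 0: [rot 0], [rot 1], [rot 2]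
   are rho_1, rho_2, rho_3, and [coord 0], [coord 1], [coord 2] are x, y, z. *)
Definition rot (F : finFieldType) (i : 'I_3) (P : point F) : point F :=
  let: (x, y, z) := P in
  match val i with
  | 0 => (x, z, 3 * x * z - y)
  | 1 => (3 * x * y - z, y, x)
  | _ => (y, 3 * y * z - x, z)
  end.

Definition coord (F : finFieldType) (j : 'I_3) (P : point F) : F :=
  let: (x, y, z) := P in
  match val j with 0 => x | 1 => y | _ => z end.

Definition edge (F : finFieldType) : rel (point F) := fun P Q =>
  [&& Mstar P, Mstar Q & [exists i, (Q == rot i P) || (P == rot i Q)]].

(* The letters of a word are applied from left to right:
   [:: i_1; ...; i_n] sends P to rho_(i_n) (... (rho_(i_1) P)). *)
Definition apply_word (F : finFieldType) (P : point F) (w : seq 'I_3) :=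
  foldl (fun R i => rot i R) P w.

(* The vertices successively visited after P. *)
Definition trace (F : finFieldType) (P : point F) (w : seq 'I_3) :=
  scanl (fun R i => rot i R) P w.

(* Paths have about q steps, so words are written with exponents, which are
   stored in binary: (i, e) stands for rho_i repeated e times. *)
Definition pword := seq ('I_3 * nat).

Definition expand (w : pword) : seq 'I_3 :=
  flatten [seq nseq ie.2 ie.1 | ie <- w].

Definition is_path (F : finFieldType) (P Q : point F) (w : pword) : bool :=
  path (@edge F) P (trace P (expand w)) && (apply_word P (expand w) == Q).

(** * The heuristics *)

Definition max_hyp (F : finFieldType) (t : F) : bool :=
  (t != 0) &&
  [exists u : {unit F}, generator [set: {unit F}] u &&
                        root ('X^2 - (3 * t) *: 'X + 1) (FinRing.uval u)].

(* "x is approximately y": equality up to the constant factor K.  A factor is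
   needed, rather than a relative error below 1: for a = b or a = -b the
   probability of heuristic B is about twice the generic one. *)
Definition approx (K x y : rat) : bool := (y <= K * x) && (x <= K * y).

(* Uniform words of length n in the two rotations other than rho_j, and the
   coordinate j of the endpoint; j = 1 is the case of y, rho_1 and rho_3.  The
   estimate is required only of walks of length at least n0, as the endpoint
   of a very short walk takes too few values. *)
Definition walk_prob (F : finFieldType) (n : nat) (j : 'I_3) (P : point F)
  : rat :=
  #|[set w : n.-tuple 'I_3 | all (predC1 j) w
                             & max_hyp (coord j (apply_word P w))]|%:R
  / #|[set w : n.-tuple 'I_3 | all (predC1 j) w]|%:R.

Definition heuristicA (K : rat) (n0 : nat) (F : finFieldType) (P : point F) :=
  forall (n : nat) (j : 'I_3), (n0 <= n)%N ->
    approx K (walk_prob n j P)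
             (2^-1 * ((totient #|F|.-1)%:R / #|F|.-1%:R)).

Definition on_curve (F : finFieldType) (a b : F) (P : point F) : bool :=
  let: (x, y, z) := P in (markoffF x a z == 0) && (markoffF x y b == 0).

Definition curve_prob (F : finFieldType) (a b : F) : rat :=
  #|[set t : F | [&& t != 0, max_hyp t
                   & [exists y, exists z, on_curve a b (t, y, z)]]]|%:R
  / #|[set t : F | t != 0]|%:R.

(* Only asked of maximally hyperbolic a and b.  It fails at a = 2/3 when -1 is
   not a square: then F(X, a, Z) = (X - Z)^2 + a^2 has no zero. *)
Definition heuristicB (K : rat) (F : finFieldType) :=
  forall a b : F, max_hyp a -> max_hyp b ->
    approx K (curve_prob a b) (8^-1 * ((totient #|F|.-1)%:R / #|F|%:R)).

(** * Randomized algorithms *)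

(* A random-access machine with an unbounded memory of natural numbers, charged
   by bit length, and registers holding elements of F, which are accessible
   only through the field operations.  A program is a finite text that does not
   depend on F.  Loops are bounded, so every program terminates. *)

Inductive iexp :=
  | IConst of nat
  | ICell of iexp
  | IBits of iexp
  | IAdd of iexp & iexp
  | ISub of iexp & iexp
  | IMul of iexp & iexp
  | IDiv of iexp & iexp
  | IMod of iexp & iexp.

Inductive fexp :=
  | FReg of nat
  | FZero
  | FOne
  | FAdd of fexp & fexp
  | FOpp of fexp
  | FMul of fexp & fexp
  | FInv of fexp.

Inductive bexp :=
  | BFEq of fexp & fexp
  | BILe of iexp & iexp.

Inductive cmd :=
  | Skip
  | Seq of cmd & cmd
  | If of bexp & cmd & cmd
  | For of iexp & cmd             (* repeat; the count is evaluated once *)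
  | ISet of iexp & iexp           (* address, value *)
  | FSet of nat & fexp
  | FSqrt of nat & fexp
  | FRand of nat                  (* uniform element of F *)
  | Flip of iexp                  (* uniform bit, stored at an address *)
  | Factor of iexp & iexp         (* address of the result, number *)
  | DLog of iexp & fexp & fexp    (* address of the result, base, argument *)
  | Emit of 'I_3 & iexp.          (* append a syllable to the output *)

(* The subroutines the machine may call, with the running times charged. *)
Record env (F : finFieldType) := Env {
  sqrt_of : F -> F;
  dlog_of : F -> F -> nat;
  time_op : nat -> nat;           (* field operation or square root, from q *)
  time_factor : nat -> nat;       (* factorization of N, from N *)
  time_dlog : nat -> nat          (* discrete logarithm, from q *)
}.

(* Nothing is known of the answers of the subroutines outside their domain. *)
Definition correct_env (F : finFieldType) (E : env F) : Prop :=
  (forall x : F, sqrt_of E (x ^+ 2) ^+ 2 = x ^+ 2) /\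
  (forall g h : {unit F}, generator [set: {unit F}] g ->
     let n := dlog_of E (FinRing.uval g) (FinRing.uval h) in
     (n < #|F|.-1)%N /\ (g ^+ n)%g = h).

Record state (F : finFieldType) := State {
  imem : nat -> nat;
  freg : nat -> F;
  output : pword;
  clock : nat
}.

Definition bits (n : nat) : nat := (trunc_log 2 n).+1.

Section Semantics.

Local Open Scope nat_scope.

Fixpoint ival (m : nat -> nat) (e : iexp) : nat :=
  match e with
  | IConst n => n
  | ICell a => m (ival m a)
  | IBits a => bits (ival m a)
  | IAdd a b => ival m a + ival m b
  | ISub a b => ival m a - ival m b
  | IMul a b => ival m a * ival m b
  | IDiv a b => ival m a %/ ival m b
  | IMod a b => ival m a %% ival m b
  end.

(* Quadratic in the number of bits of the operands, as for schoolbook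
   arithmetic. *)
Fixpoint icost (m : nat -> nat) (e : iexp) : nat :=
  match e with
  | IConst n => bits n
  | ICell a => icost m a + bits (ival m a) + bits (m (ival m a))
  | IBits a => icost m a + bits (ival m a)
  | IAdd a b | ISub a b | IMul a b | IDiv a b | IMod a b =>
      icost m a + icost m b + (bits (ival m a) + bits (ival m b)) ^ 2
  end.

Fixpoint fval (F : finFieldType) (r : nat -> F) (e : fexp) : F :=
  match e with
  | FReg n => r n
  | FZero => 0%R
  | FOne => 1%R
  | FAdd a b => (fval r a + fval r b)%R
  | FOpp a => (- fval r a)%R
  | FMul a b => (fval r a * fval r b)%R
  | FInv a => ((fval r a)^-1)%R
  end.

Fixpoint fsize (e : fexp) : nat :=
  match e with
  | FReg _ | FZero | FOne => 1
  | FAdd a b | FMul a b => (fsize a + fsize b).+1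
  | FOpp a | FInv a => (fsize a).+1
  end.

Definition fcost (F : finFieldType) (E : env F) (e : fexp) : nat :=
  fsize e * time_op E #|F|.

Definition bval (F : finFieldType) (s : state F) (b : bexp) : bool :=
  match b with
  | BFEq a b => fval (freg s) a == fval (freg s) b
  | BILe a b => ival (imem s) a <= ival (imem s) b
  end.

Definition bcost (F : finFieldType) (E : env F) (s : state F) (b : bexp) :=
  match b with
  | BFEq a b => fcost E a + fcost E b + time_op E #|F|
  | BILe a b => icost (imem s) a + icost (imem s) b
  end.

Definition tick (F : finFieldType) (k : nat) (s : state F) : state F :=
  State (imem s) (freg s) (output s) (clock s + k).

Definition iset (F : finFieldType) (a v : nat) (s : state F) : state F :=
  State [eta imem s with a |-> v] (freg s) (output s) (clock s).

Definition fset (F : finFieldType) (x : nat) (v : F) (s : state F) : state F :=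
  State (imem s) [eta freg s with x |-> v] (output s) (clock s).

Definition emit (F : finFieldType) (i : 'I_3) (e : nat) (s : state F) :=
  State (imem s) (freg s) (rcons (output s) (i, e)) (clock s).

Definition iblock (F : finFieldType) (a : nat) (l : seq nat) (s : state F) :=
  State (fun n => if a <= n < a + size l then nth 0 l (n - a) else imem s n)
        (freg s) (output s) (clock s).

(* k, p_1, e_1, ..., p_k, e_k for N = p_1 ^ e_1 * ... * p_k ^ e_k *)
Definition factor_block (N : nat) : seq nat :=
  size (prime_decomp N) ::
  flatten [seq [:: pe.1; pe.2] | pe <- prime_decomp N].

End Semantics.

(* [expect E c f s] is the expected value of f at the final state of a run of c
   from s, over the random choices of the run. *)
Fixpoint expect (F : finFieldType) (E : env F) (c : cmd)
    (f : state F -> rat) (s : state F) {struct c} : rat :=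
  let m := imem s in
  let r := freg s in
  match c with
  | Skip => f s
  | Seq c1 c2 => expect E c1 (expect E c2 f) s
  | If b c1 c2 =>
      let s' := tick (bcost E s b).+1 s in
      if bval s b then expect E c1 f s' else expect E c2 f s'
  | For e c1 =>
      iter (ival m e) (fun g s' => expect E c1 g (tick 1 s')) f
           (tick (icost m e).+1 s)
  | ISet a e =>
      f (iset (ival m a) (ival m e)
           (tick (icost m a + icost m e
                  + bits (ival m a) + bits (ival m e))%N s))
  | FSet x e => f (fset x (fval r e) (tick (fcost E e).+1 s))
  | FSqrt x e =>
      f (fset x (sqrt_of E (fval r e))
           (tick (fcost E e + time_op E #|F|).+1 s))
  | FRand x =>
      (\sum_(t : F) f (fset x t (tick (time_op E #|F|).+1 s))) / #|F|%:R
  | Flip a =>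
      let s' := tick (icost m a + bits (ival m a))%N s in
      (f (iset (ival m a) 0%N s') + f (iset (ival m a) 1%N s')) / 2
  | Factor a e =>
      f (iblock (ival m a) (factor_block (ival m e))
           (tick (icost m a + icost m e + time_factor E (ival m e))%N s))
  | DLog a g h =>
      f (iset (ival m a) (dlog_of E (fval r g) (fval r h))
           (tick (icost m a + fcost E g + fcost E h
                  + time_dlog E #|F|)%N s))
  | Emit i e =>
      f (emit i (ival m e) (tick (icost m e + bits (ival m e))%N s))
  end.

(* The input: q in cell 0, the coordinates of P in registers 0, 1, 2 and those
   of Q in registers 3, 4, 5. *)
Definition init (F : finFieldType) (P Q : point F) : state F :=
  let: (x, y, z) := P in
  let: (x', y', z') := Q in
  State (fun n => if n == 0%N then #|F| else 0%N)
        (fun n => nth 0 [:: x; y; z; x'; y'; z'] n) [::] 0.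

Definition prob (F : finFieldType) (E : env F) (c : cmd)
    (A : pred (state F)) (s : state F) : rat :=
  expect E c (fun s' => (A s')%:R) s.

(* The success event: a path from P to Q is output within time T. *)
Definition finds_path (F : finFieldType) (P Q : point F) (T : nat)
  : pred (state F) :=
  fun s => is_path P Q (output s) && (clock s <= T)%N.

Definition polylog (f : nat -> nat) : Prop :=
  exists c k : nat, forall q, (f q <= c * bits q ^ k)%N.

(* Main.v *)
(** If the i-th coordinate a of a point is maximally hyperbolic, with eigenvalue
    l, then rho_i acts on the conic of solutions with that coordinate as
    multiplication by the generator l, in the coordinate u - v / l.  So any two
    points of this conic are joined by a power of rho_i, found by one discrete
    logarithm.  Random walks lead from P to a point with maximally hyperbolic y
    (Heuristic A), and likewise from Q to one with maximally hyperbolic z; a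
    random maximally hyperbolic t on the curve C_(y,z) (Heuristic B) gives two
    points with x = t, one on each conic, so three discrete logarithms connect
    the ends of the walks.  The walk from Q is run backwards by replacing each
    rotation by its power of exponent |GL_2(F_q)| - 1.

    Since q - 1 <= phi(q - 1) * bits q, a trial succeeds with probability at
    least 1 / O(bits q), so O((bits q)^2) trials make each of the three searches
    fail with probability at most 1 / (4 q).  The factorization of q - 1 serves
    to recognize generators of F_q^*. *)

From mathcomp Require Import all_boot all_order all_fingroup all_algebra.
From mathcomp Require Import cyclic finfield zify ring lra.
Require Import Defs.

Set Implicit Arguments.
Unset Strict Implicit.
Unset Printing Implicit Defensive.

Import Order.TTheory GRing.Theory Num.Theory.
Local Open Scope ring_scope.

(** * Verification of programs *)

(** Three features of the machine shape the proof. Output cannot be withdrawn, while a walk may miss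
    its goal; so walks are stored as integers, one bit per letter, and nothing is emitted before all
    three searches have succeeded. Only one factorization and three logarithms are allowed, so these
    calls stand outside every loop, where a count taken from the program text is exact. And the
    semantics yields only the mean of a function of the final state, clock included; so correctness
    and probabilities are proved in a clock-free semantics ([safe], [pr]), and a time bound is
    proved once for all programs from a width [S] that limits loop counts and bit lengths.

    The walk from Q is undone with the group order as exponent because the coordinates met along a
    walk are arbitrary: rho_i may act with eigenvalues outside F_q, or without being diagonalizable,
    and this one exponent serves in all cases. *)

Section Logic.

Variables (F : finFieldType) (E : env F) (S : nat).

Implicit Types (c : cmd) (s : state F) (Q : state F -> Prop) (f : state F -> rat).

Definition erase s : state F := State (imem s) (freg s) (output s) 0.

(* A weakest precondition over all random choices, blind to the clock.  It also
   requires every number written to have at most S bits and every loop count to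
   be at most S, so that a running time can be read off the program text. *)
Fixpoint safe c Q s {struct c} : Prop :=
  let m := imem s in
  let r := freg s in
  match c with
  | Skip => Q s
  | Seq c1 c2 => safe c1 (safe c2 Q) s
  | If b c1 c2 => if bval s b then safe c1 Q s else safe c2 Q s
  | For e c1 => (ival m e <= S)%N /\ iter (ival m e) (safe c1) Q s
  | ISet a e => (bits (ival m e) <= S)%N /\ Q (iset (ival m a) (ival m e) s)
  | FSet x e => Q (fset x (fval r e) s)
  | FSqrt x e => Q (fset x (sqrt_of E (fval r e)) s)
  | FRand x => forall t, Q (fset x t s)
  | Flip a => Q (iset (ival m a) 0%N s) /\ Q (iset (ival m a) 1%N s)
  | Factor a e =>
      [/\ ival m e = #|F|.-1,
          all (fun v => bits v <= S)%N (factor_block (ival m e))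
        & Q (iblock (ival m a) (factor_block (ival m e)) s)]
  | DLog a g h =>
      (bits (dlog_of E (fval r g) (fval r h)) <= S)%N /\
      Q (iset (ival m a) (dlog_of E (fval r g) (fval r h)) s)
  | Emit i e => Q (emit i (ival m e) s)
  end.

(** The counterpart of [expect] in which every [tick] is dropped. *)
Fixpoint pr c f s {struct c} : rat :=
  let m := imem s in
  let r := freg s in
  match c with
  | Skip => f s
  | Seq c1 c2 => pr c1 (pr c2 f) s
  | If b c1 c2 => if bval s b then pr c1 f s else pr c2 f s
  | For e c1 => iter (ival m e) (pr c1) f s
  | ISet a e => f (iset (ival m a) (ival m e) s)
  | FSet x e => f (fset x (fval r e) s)
  | FSqrt x e => f (fset x (sqrt_of E (fval r e)) s)
  | FRand x => (\sum_(t : F) f (fset x t s)) / #|F|%:R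
  | Flip a => (f (iset (ival m a) 0%N s) + f (iset (ival m a) 1%N s)) / 2
  | Factor a e => f (iblock (ival m a) (factor_block (ival m e)) s)
  | DLog a g h => f (iset (ival m a) (dlog_of E (fval r g) (fval r h)) s)
  | Emit i e => f (emit i (ival m e) s)
  end.

Lemma eq_pr c f g s : f =1 g -> pr c f s = pr c g s.
Proof.
elim: c f g s => [|c1 IH1 c2 IH2|b c1 IH1 c2 IH2|e c1 IH1|a e|x e|x e|x|a|a e
  |a g0 h|i e] f g s fg //=.
- by apply: IH1 => s'; apply: IH2.
- by case: (bval s b); [apply: IH1|apply: IH2].
- move: (ival _ e) => n; elim: n s => [|k IHk] s /=; first exact: fg.
  exact: IH1.
- by congr (_ / _); apply: eq_bigr => t _.
- by rewrite !fg.
Qed.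

Lemma eq_expect c f g s : f =1 g -> expect E c f s = expect E c g s.
Proof.
elim: c f g s => [|c1 IH1 c2 IH2|b c1 IH1 c2 IH2|e c1 IH1|a e|x e|x e|x|a|a e
  |a g0 h|i e] f g s fg //=.
- by apply: IH1 => s'; apply: IH2.
- by case: (bval s b); [apply: IH1|apply: IH2].
- move: (ival _ e) => n; elim: n (tick _ _) => [|k IHk] s' /=; first exact: fg.
  exact: IH1.
- by congr (_ / _); apply: eq_bigr => t _.
- by rewrite !fg.
Qed.

(** No test, address or value depends on the clock, so a function of the final state that ignores
    the clock has the same mean in both semantics. *)
Lemma expect_erase c f s :
  expect E c (fun s' => f (erase s')) s = pr c f (erase s).
Proof.
elim: c f s => //= [c1 IH1 c2 IH2|b c1 IH1 c2 IH2|e c1 IH1] f s.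
- by rewrite -IH1; apply: eq_expect => s'; rewrite IH2.
- have -> : bval (erase s) b = bval s b by case: b.
  by case: (bval s b); rewrite ?IH1 ?IH2.
- rewrite -[RHS]/(iter (ival (imem s) e) (pr c1) f
                    (erase (tick (icost (imem s) e).+1 s))).
  move: (tick _ s) => s1.
  move: (ival _ e) => n; elim: n s1 => //= k IHk s1.
  rewrite (@eq_expect _ _ (fun s' => iter k (pr c1) f (erase s'))) //.
  by rewrite IH1.
Qed.

Lemma safe_mono c Q Q' s :
  (forall s', Q s' -> Q' s') -> safe c Q s -> safe c Q' s.
Proof.
elim: c Q Q' s => //= [|c1 IH1 c2 IH2|b c1 IH1 c2 IH2|e c1 IH1|a e|x e|x e|x|a|a e
  |a g h|i e] Q Q' s QQ'.
- exact: QQ'.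
- by apply: IH1 => s'; apply: IH2.
- by case: (bval s b); [apply: IH1|apply: IH2].
- case=> -> H; split=> //; move: (ival _ e) H => n; elim: n s => [|k IHk] s /=.
    exact: QQ'.
  by apply: IH1.
- by case=> -> /QQ'.
- exact: QQ'.
- exact: QQ'.
- by move=> H t; apply: QQ'.
- by case=> /QQ' ? /QQ'.
- by case=> ? ? /QQ'.
- by case=> -> /QQ'.
- exact: QQ'.
Qed.

(** The invariant is indexed by the number of iterations still to run, because the outermost layer
    of [iter] is executed first. *)
Lemma safe_loop (I : nat -> state F -> Prop) e c Q s :
  (ival (imem s) e <= S)%N ->
  I (ival (imem s) e) s ->
  (forall k s', (k < ival (imem s) e)%N -> I k.+1 s' -> safe c (I k) s') ->
  (forall s', I 0%N s' -> Q s') ->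
  safe (For e c) Q s.
Proof.
move=> leS I0 Istep IQ; split=> //.
move: (ival _ e) I0 Istep {leS} => k; elim: k s => /= [|k IHk] s Is Istep.
  exact: IQ.
apply: safe_mono (Istep k s _ Is) => // s' Is'.
by apply: IHk => // j s'' jk; apply: Istep; apply: ltnW.
Qed.

Lemma pr_cst c (x : rat) s : pr c (fun=> x) s = x.
Proof.
elim: c s => //= [c1 IH1 c2 IH2|b c1 IH1 c2 IH2|e c1 IH1|y|a] s.
- by rewrite (@eq_pr _ _ (fun=> x)).
- by case: (bval s b).
- by move: (ival _ e) => n; elim: n s => //= k IHk s; rewrite (@eq_pr _ _ (fun=> x)).
- rewrite sumr_const -[_ *+ _]mulr_natr mulfK // pnatr_eq0 -lt0n.
  by apply/card_gt0P; exists 0.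
- by rewrite -mulr2n -[x *+ 2]mulr_natr mulfK.
Qed.

(** Linearity together with total mass one; [pr_search] applies it to an affine function of a
    success indicator. *)
Lemma pr_affine c (x y : rat) f s :
  pr c (fun s' => x + y * f s') s = x + y * pr c f s.
Proof.
elim: c f s => //= [c1 IH1 c2 IH2|b c1 IH1 c2 IH2|e c1 IH1|z|a] f s.
- by rewrite -IH1; apply: eq_pr.
- by case: (bval s b).
- move: (ival _ e) => n; elim: n f s => //= k IHk f s.
  by rewrite -IH1; apply: eq_pr.
- rewrite big_split /= -mulr_sumr mulrDl mulrA; congr (_ + _).
  exact: (pr_cst (FRand z) x s).
- by rewrite addrACA -mulrDr mulrDl -mulrA -mulr2n -[x *+ 2]mulr_natr mulfK.
Qed.

(** The comparison is needed only at final states that [safe] allows. This is how postconditions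
    enter probability estimates. *)
Lemma pr_le c Q f g s :
  safe c Q s -> (forall s', Q s' -> f s' <= g s') -> pr c f s <= pr c g s.
Proof.
elim: c Q f g s => //= [|c1 IH1 c2 IH2|b c1 IH1 c2 IH2|e c1 IH1|a e|x e|x e|x|a|a e
  |a g0 h|i e] Q f g s.
- by move=> ? ->.
- by move=> H fg; apply: IH1 H _ => s' /IH2; apply.
- by case: (bval s b); [apply: IH1|apply: IH2].
- case=> _; move: (ival _ e) => n; elim: n s => /= [|k IHk] s H fg; first exact: fg.
  by apply: IH1 H _ => s' H; apply: IHk.
- by case=> _ H; apply.
- by move=> H; apply.
- by move=> H; apply.
- move=> H fg; rewrite ler_pM2r ?invr_gt0 ?ltr0n; last first.
    by apply/card_gt0P; exists 0.
  by apply: ler_sum => t _; apply: fg.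
- by case=> H0 H1 fg; rewrite ler_pM2r // lerD ?fg.
- by case=> _ _ H; apply.
- by case=> _ H; apply.
- by move=> H; apply.
Qed.

Lemma pr_ge c Q f (x : rat) s :
  safe c Q s -> (forall s', Q s' -> x <= f s') -> x <= pr c f s.
Proof. by move=> H fx; rewrite -(pr_cst c x s); apply: pr_le H _. Qed.

Lemma pr_ge0 c f s : (forall s', 0 <= f s') -> 0 <= pr c f s.
Proof.
elim: c f s => //= [c1 IH1 c2 IH2|b c1 IH1 c2 IH2|e c1 IH1|x|a] f s f0.
- by apply: IH1 => s'; apply: IH2.
- by case: (bval s b); [apply: IH1|apply: IH2].
- by move: (ival _ e) => n; elim: n s => //= k IHk s; apply: IH1.
- by rewrite divr_ge0 ?ler0n // sumr_ge0.
- by rewrite divr_ge0 // addr_ge0.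
Qed.

End Logic.

(** * Cells and registers left unchanged by a program *)

Section Frame.

Variables (F : finFieldType) (E : env F) (S : nat).

Implicit Types (c : cmd) (s : state F) (Q : state F -> Prop) (f : state F -> rat).

Fixpoint cells_of c : seq nat :=
  match c with
  | Seq c1 c2 | If _ c1 c2 => cells_of c1 ++ cells_of c2
  | For _ c1 => cells_of c1
  | ISet (IConst a) _ | Flip (IConst a) | DLog (IConst a) _ _ => [:: a]
  | _ => [::]
  end.

Fixpoint regs_of c : seq nat :=
  match c with
  | Seq c1 c2 | If _ c1 c2 => regs_of c1 ++ regs_of c2
  | For _ c1 => regs_of c1
  | FSet x _ | FSqrt x _ | FRand x => [:: x]
  | _ => [::]
  end.

(** Ensures that [cells_of] misses no cell: addresses must be constants, and [Factor] is excluded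
    since the length of its block depends on the data. The flag [noisy] permits output. *)
Fixpoint framed (noisy : bool) c : bool :=
  match c with
  | Seq c1 c2 | If _ c1 c2 => framed noisy c1 && framed noisy c2
  | For _ c1 => framed noisy c1
  | ISet a _ | Flip a | DLog a _ _ => if a is IConst _ then true else false
  | Factor _ _ => false
  | Emit _ _ => noisy
  | _ => true
  end.

Definition agree (noisy : bool) (A B : seq nat) s s' : Prop :=
  [/\ noisy \/ output s' = output s,
      forall a, a \notin A -> imem s' a = imem s a
    & forall x, x \notin B -> freg s' x = freg s x].

Lemma agree_refl w A B s : agree w A B s s.
Proof. by split=> //; right. Qed.

Lemma agree_trans w A B s1 s2 s3 :
  agree w A B s1 s2 -> agree w A B s2 s3 -> agree w A B s1 s3.
Proof.
case=> o1 m1 r1 [o2 m2 r2]; split=> [|a aA|x xB].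
- by case: o1 => [|<-]; [left|].
- by rewrite m2 ?m1.
- by rewrite r2 ?r1.
Qed.

Lemma agree_sub w A B A' B' s s' : {subset A <= A'} -> {subset B <= B'} ->
  agree w A B s s' -> agree w A' B' s s'.
Proof.
move=> sA sB [o m r]; split=> // [a aA|x xB]; [apply: m|apply: r].
  by apply: contra aA; apply: sA.
by apply: contra xB; apply: sB.
Qed.

Lemma agree_iset w A B a v s : a \in A -> agree w A B s (iset a v s).
Proof.
move=> aA; split=> [|b bA|] //=; first by right.
by rewrite ifN //; apply: contraNneq bA => ->.
Qed.

Lemma agree_fset w A B x v s : x \in B -> agree w A B s (fset x v s).
Proof.
move=> aA; split=> [|//|b bA] //=; first by right.
by rewrite ifN //; apply: contraNneq bA => ->.
Qed.

(** Supersets [A] and [B] let both halves of a [Seq] be treated with the same sets. *)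
Lemma safe_frame_sub w A B c Q s : framed w c ->
    {subset cells_of c <= A} -> {subset regs_of c <= B} ->
  safe E S c Q s -> safe E S c (fun s' => Q s' /\ agree w A B s s') s.
Proof.
elim: c Q s => [|c1 IH1 c2 IH2|b c1 IH1 c2 IH2|e c1 IH1|a e|x e|x e|x|a|a e
  |a g h|i e] Q s //=.
- by move=> _ _ _ ?; split=> //; apply: agree_refl.
- case/andP=> w1 w2 sA sB /IH1-/(_ w1).
  have sA1 : {subset cells_of c1 <= A} by move=> a H; apply: sA; rewrite mem_cat H.
  have sA2 : {subset cells_of c2 <= A}.
    by move=> a H; apply: sA; rewrite mem_cat H orbT.
  have sB1 : {subset regs_of c1 <= B} by move=> a H; apply: sB; rewrite mem_cat H.
  have sB2 : {subset regs_of c2 <= B}.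
    by move=> a H; apply: sB; rewrite mem_cat H orbT.
  move=> /(_ sA1 sB1); apply: safe_mono => s1 [/IH2 H a1].
  apply: safe_mono (H w2 sA2 sB2) => s2 [? a2]; split=> //.
  exact: agree_trans a1 a2.
- case/andP=> w1 w2 sA sB; case: (bval s b).
    apply: IH1 => // a H; [apply: sA|apply: sB]; by rewrite mem_cat H.
  by apply: IH2 => // a H; [apply: sA|apply: sB]; rewrite mem_cat H orbT.
- move=> wc sA sB [leS H]; split=> //; move: (ival _ e) H => n {leS}.
  elim: n s => [|n IHn] s /=; first by split=> //; apply: agree_refl.
  move/(IH1 _ _ wc sA sB); apply: safe_mono => s1 [/IHn H a1].
  have mono Q1 Q2 k s' : (forall s, Q1 s -> Q2 s) ->
      iter k (safe E S c1) Q1 s' -> iter k (safe E S c1) Q2 s'.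
    move=> Q12; elim: k s' => [|k IHk] s' /=; first exact: Q12.
    exact: safe_mono.
  apply: mono H => s2 [? a2]; split=> //; exact: agree_trans a1 a2.
- case: a => //= a _ sA _ [-> ?]; split=> //; split=> //.
  by apply: agree_iset; apply: sA; rewrite inE.
- by move=> _ _ sB ?; split=> //; apply: agree_fset; apply: sB; rewrite inE.
- by move=> _ _ sB ?; split=> //; apply: agree_fset; apply: sB; rewrite inE.
- by move=> _ _ sB ? t; split=> //; apply: agree_fset; apply: sB; rewrite inE.
- case: a => //= a _ sA _ [H0 H1].
  by split; split=> //; apply: agree_iset; apply: sA; rewrite inE.
- case: a => //= a _ sA _ [-> ?]; split=> //; split=> //.
  by apply: agree_iset; apply: sA; rewrite inE.
- by move=> -> _ _ ?; split=> //; split=> //; left.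
Qed.

Lemma safe_frame w c Q s : safe E S c Q s -> framed w c ->
  safe E S c (fun s' => Q s' /\ agree w (cells_of c) (regs_of c) s s') s.
Proof. by move=> H wc; apply: safe_frame_sub. Qed.

(** * Searching by repeated trials *)

(** Loops cannot be left early; once the flag in cell [a] is set, the remaining iterations do
    nothing. *)
Definition unless (a : nat) c := If (BILe (IConst 1) (ICell (IConst a))) Skip c.

Definition search (e : iexp) (a : nat) c := For e (unless a c).

Lemma safe_search (I : state F -> Prop) e a c s : I s ->
    (ival (imem s) e <= S)%N ->
    (forall s', I s' -> imem s' a = 0%N -> safe E S c I s') ->
  safe E S (search e a c) I s.
Proof.
move=> Is leS Ic; apply: (@safe_loop _ _ _ (fun=> I)) => // k s' _ Is' /=.
by case: ltnP => // /[1!leqn0] /eqP; apply: Ic.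
Qed.

(** Here [p] bounds the chance of success of one trial and [x] the value of the continuation [f]
    after a success; after a failure [f] need only be nonnegative. *)
Lemma pr_search (I : state F -> Prop) e a c f (p x : rat) s : I s ->
    (forall s', I s' -> imem s' a = 0%N -> safe E S c I s') ->
    (forall s', I s' -> imem s' a = 0%N ->
       p <= pr E c (fun s'' => (0 < imem s'' a)%N%:R) s') ->
    0 <= p <= 1 -> 0 <= x -> (forall s', 0 <= f s') ->
    (forall s', I s' -> (0 < imem s' a)%N -> x <= f s') ->
  (1 - (1 - p) ^+ ival (imem s) e) * x <= pr E (search e a c) f s.
Proof.
move=> Is Ic Pc /andP[p0 p1] x0 f0 fx; rewrite /search /=.
move: (ival _ e) => n.
pose g k := iter k (pr E (unless a c)) f.
have q0 k : 0 <= (1 - p) ^+ k by rewrite exprn_ge0 // subr_ge0.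
have g0 k s' : 0 <= g k s'.
  by elim: k s' => [|k IHk] s'; [apply: f0|apply: pr_ge0].
have gx k s' : I s' -> (0 < imem s' a)%N -> x <= g k s'.
  elim: k s' => [|k IHk] s' Is' as'; first exact: fx.
  by rewrite /g /= as'; apply: IHk.
have qle1 k : (1 - p) ^+ k <= 1.
  by apply: exprn_ile1; [rewrite subr_ge0|rewrite lerBlDr lerDl].
elim: n s Is => [|n IHn] s Is /=.
  by rewrite expr0 subrr mul0r.
case: ltnP => [as0|].
  apply: le_trans (gx n s Is as0).
  by rewrite -[leRHS]mul1r ler_wpM2r // lerBlDr lerDl.
rewrite leqn0 => /eqP as0.
(* [y] bounds the value when the present trial fails. The mean is then at least y + (x - y) p, and
   this is the bound for n + 1 trials because x - y = (1 - p)^n x. *)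
pose y := (1 - (1 - p) ^+ n) * x.
pose h s' : rat := y + (x - y) * (0 < imem s' a)%N%:R.
have : pr E c h s <= pr E c (g n) s.
  apply: pr_le (Ic s Is as0) _ => s' Is'; rewrite /h.
  case: ltnP => as'; first by rewrite mulr1 addrCA subrr addr0; apply: gx.
  by rewrite mulr0 addr0; apply: IHn.
apply: le_trans; rewrite pr_affine.
have yx : 0 <= x - y.
  by rewrite subr_ge0 -[leRHS]mul1r ler_wpM2r // lerBlDr lerDl.
have := ler_wpM2l yx (Pc s Is as0).
rewrite -(lerD2l y); apply: le_trans.
by rewrite /y exprS le_eqVlt; apply/orP; left; apply/eqP; ring.
Qed.

End Frame.

(** By Bernoulli (1 + p)^m >= 1 + m p >= 2, while (1 - p)^m (1 + p)^m <= 1; so m trials in a row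
    fail with probability at most 1/2. *)
Lemma fail_prob_le (p : rat) (m L : nat) : 0 <= p <= 1 -> 1 <= m%:R * p ->
  (1 - p) ^+ (m * L) <= 2 ^- L.
Proof.
case/andP=> p0 p1 mp; rewrite exprM -exprVn.
have half : (1 - p) ^+ m <= 2^-1.
  have bern : 1 + m%:R * p <= (1 + p) ^+ m.
    elim: m {mp} => [|m IH]; first by rewrite mul0r addr0 expr0.
    rewrite exprS -natr1.
    have p1' : 0 <= 1 + p by rewrite addr_ge0.
    apply: le_trans (ler_wpM2l p1' IH).
    have := mulr_ge0 (ler0n rat m) (mulr_ge0 p0 p0); nra.
  have two : 2 <= (1 + p) ^+ m by apply: le_trans bern; rewrite (_ : 2 = 1 + 1) // lerD2l.
  have q0 : 0 <= (1 - p) ^+ m by rewrite exprn_ge0 // subr_ge0.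
  have : (1 - p) ^+ m * 2 <= 1.
    apply: le_trans (ler_wpM2l q0 two) _.
    rewrite -exprMn exprn_ile1 //; nra.
  by rewrite -ler_pdivlMr // mul1r.
by apply: lerXn2r; rewrite ?nnegrE ?exprn_ge0 ?subr_ge0 ?invr_ge0.
Qed.

(** * Running time *)

Lemma bits_gt0 n : (0 < bits n)%N. Proof. by []. Qed.

(** The condition on [k] is due to [bits 0] being 1. *)
Lemma bits_leP n k : (0 < k)%N -> (bits n <= k)%N = (n < 2 ^ k)%N.
Proof.
move=> k0; rewrite /bits; case: n => [|n]; first by rewrite trunc_log0 expn_gt0.
have /andP[lo hi] := @trunc_log_bounds 2 n.+1 isT isT.
apply/idP/idP => [le|lt]; first by apply: leq_trans hi _; rewrite leq_exp2l.
by rewrite -(@ltn_exp2l 2) //; apply: leq_ltn_trans lt.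
Qed.

Lemma ltn_bits n : (n < 2 ^ bits n)%N.
Proof. by rewrite -bits_leP. Qed.

Lemma leq_bits m n : (m <= n)%N -> (bits m <= bits n)%N.
Proof. by move=> mn; rewrite bits_leP //; apply: leq_ltn_trans mn (ltn_bits n). Qed.

Lemma bits_le_succ n : (bits n <= n.+1)%N.
Proof. by rewrite bits_leP // (ltn_trans (ltnSn n)) // ltn_expl. Qed.

Lemma bits_le n : (0 < n)%N -> (bits n <= n)%N.
Proof. by move=> n0; rewrite bits_leP // ltn_expl. Qed.

Lemma bits_add m n : (bits (m + n) <= bits m + bits n)%N.
Proof.
rewrite bits_leP ?addn_gt0 ?bits_gt0 // expnD.
have := ltn_bits m; have := ltn_bits n.
have := bits_gt0 m; have := bits_gt0 n.
case: (bits m) (bits n) => // a [|b] // _ _; rewrite !expnS.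
have := expn_gt0 2 a; have := expn_gt0 2 b; rewrite /=.
move: (2 ^ a)%N (2 ^ b)%N => A B; nia.
Qed.

Lemma bits_mul m n : (bits (m * n) <= bits m + bits n)%N.
Proof.
rewrite bits_leP ?addn_gt0 ?bits_gt0 // expnD.
have := ltn_bits m; have := ltn_bits n.
move: (2 ^ _)%N (2 ^ _)%N => A B; nia.
Qed.

Section Time.

Local Open Scope nat_scope.

(** Bounds the bit length of a value when every cell has at most [S] bits. Truncated differences,
    quotients and remainders never exceed their first argument. *)
Fixpoint ibits (S : nat) (e : iexp) : nat :=
  match e with
  | IConst n => bits n
  | ICell a => S
  | IBits a | ISub a _ | IDiv a _ | IMod a _ => ibits S a
  | IAdd a b | IMul a b => ibits S a + ibits S b
  end.

Fixpoint itime (S : nat) (e : iexp) : nat :=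
  match e with
  | IConst n => bits n
  | ICell a => itime S a + ibits S a + S
  | IBits a => itime S a + ibits S a
  | IAdd a b | ISub a b | IMul a b | IDiv a b | IMod a b =>
      itime S a + itime S b + (ibits S a + ibits S b) ^ 2
  end.

Definition btime (S T : nat) (b : bexp) : nat :=
  match b with
  | BFEq a b => fsize a * T + fsize b * T + T
  | BILe a b => itime S a + itime S b
  end.

(* T bounds one field operation; the calls to Factor and DLog are counted
   separately, by [factor_calls] and [dlog_calls]. *)
Fixpoint ctime (S T : nat) (c : cmd) : nat :=
  match c with
  | Skip => 0
  | Seq c1 c2 => ctime S T c1 + ctime S T c2
  | If b c1 c2 => (btime S T b).+1 + (ctime S T c1 + ctime S T c2)
  | For e c1 => (itime S e).+1 + S * (ctime S T c1).+1
  | ISet a e => itime S a + itime S e + ibits S a + ibits S e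
  | FSet x e => (fsize e * T).+1
  | FSqrt x e => (fsize e * T + T).+1
  | FRand x => T.+1
  | Flip a => itime S a + ibits S a
  | Factor a e => itime S a + itime S e
  | DLog a g h => itime S a + fsize g * T + fsize h * T
  | Emit i e => itime S e + ibits S e
  end.

Fixpoint factor_calls (S : nat) (c : cmd) : nat :=
  match c with
  | Seq c1 c2 | If _ c1 c2 => factor_calls S c1 + factor_calls S c2
  | For _ c1 => S * factor_calls S c1
  | Factor _ _ => 1
  | _ => 0
  end.

Fixpoint dlog_calls (S : nat) (c : cmd) : nat :=
  match c with
  | Seq c1 c2 | If _ c1 c2 => dlog_calls S c1 + dlog_calls S c2
  | For _ c1 => S * dlog_calls S c1
  | DLog _ _ _ => 1
  | _ => 0
  end.

Variables (F : finFieldType) (E : env F) (S : nat).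
Hypothesis S_gt0 : 0 < S.

Definition bounded (s : state F) := forall a, bits (imem s a) <= S.

Lemma bits_ival m e : (forall a, bits (m a) <= S) -> bits (ival m e) <= ibits S e.
Proof.
move=> mS; elim: e => //= [a IH|a IHa b IHb|a IHa b IHb|a IHa b IHb|a IHa b IHb|a IHa b IHb].
- by apply: leq_trans IH; apply: bits_le.
- by apply: leq_trans (bits_add _ _) _; apply: leq_add.
- by apply: leq_trans IHa; apply: leq_bits; apply: leq_subr.
- by apply: leq_trans (bits_mul _ _) _; apply: leq_add.
- by apply: leq_trans IHa; apply: leq_bits; apply: leq_div.
- by apply: leq_trans IHa; apply: leq_bits; apply: leq_mod.
Qed.

Lemma icost_le m e : (forall a, bits (m a) <= S) -> icost m e <= itime S e.
Proof.
move=> mS.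
have sq a b : (bits (ival m a) + bits (ival m b)) ^ 2 <= (ibits S a + ibits S b) ^ 2.
  by rewrite leq_sqr leq_add ?bits_ival.
elim: e => //= [a IH|a IH|a IHa b IHb|a IHa b IHb|a IHa b IHb|a IHa b IHb|a IHa b IHb];
  by rewrite ?leq_add ?bits_ival.
Qed.

Lemma bcost_le s b : bounded s -> bcost E s b <= btime S (time_op E #|F|) b.
Proof. by move=> bs; case: b => //= a b; rewrite leq_add ?icost_le. Qed.

Lemma bounded_iset a v s : bounded s -> bits v <= S -> bounded (iset a v s).
Proof. by move=> bs vS b /=; case: eqP. Qed.

Let fac := time_factor E #|F|.-1.
Let dl := time_dlog E #|F|.
Let T := time_op E #|F|.

Definition clock_bound c :=
  ctime S T c + factor_calls S c * fac + dlog_calls S c * dl.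

(** There is no notion of a single run, so the time bound is expressed through means: [f] and [g]
    have to agree only at final states with a small clock. The [Factor] clause of [safe] fixes the
    number to be factored as [#|F|.-1], so each such call costs [fac]. *)
Lemma eq_expect_safe c Q f g s : bounded s -> safe E S c Q (erase s) ->
    (forall s', Q (erase s') -> bounded s' -> clock s' <= clock s + clock_bound c ->
       f s' = g s') ->
  expect E c f s = expect E c g s.
Proof.
rewrite /clock_bound.
elim: c Q f g s => [|c1 IH1 c2 IH2|b c1 IH1 c2 IH2|e c1 IH1|a e|x e|x e|x|a|a e
  |a g0 h|i e] Q f g s bs.
- by move=> /= Qs -> //; rewrite leq_addr.
- move=> /= H fg; apply: (IH1 _ _ _ _ bs H) => s1 H1 b1 le1.
  apply: (IH2 _ _ _ _ b1 H1) => s2 Q2 b2 le2.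
  by apply: fg => //; rewrite !mulnDl; lia.
- move=> H fg; have := bcost_le b bs; rewrite -/T => bT.
  move: H; rewrite /= (_ : bval (erase s) b = bval s b); last by case: (b).
  case: (bval s b) => H; [apply: (IH1 Q)|apply: (IH2 Q)] => //.
    by move=> s' Q' b' /= le'; apply: fg => //=; rewrite !mulnDl; lia.
  by move=> s' Q' b' /= le'; apply: fg => //=; rewrite !mulnDl; lia.
- move=> /= [nS H] fg.
  have eT : (icost (imem s) e) <= itime S e by apply: icost_le.
  set s1 := tick _ s; have b1 : bounded s1 by [].
  rewrite -/(imem s) in nS H.
  have {}H : iter (ival (imem s) e) (safe E S c1) Q (erase s1) by [].
  (* The cost of one iteration, including the tick that [For] charges for it. *)
  set D := (ctime S T c1).+1 + factor_calls S c1 * fac + dlog_calls S c1 * dl.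
  have {}fg s' : Q (erase s') -> bounded s' ->
      clock s' <= clock s1 + (ival (imem s) e) * D -> f s' = g s'.
    move=> Q' b' le'; apply: fg => //; apply: leq_trans le' _.
    have : ival (imem s) e * D <= S * D by rewrite leq_mul2r nS orbT.
    by rewrite /D !mulnDr !mulnA /=; lia.
  move: (ival _ e) H fg => n {nS eT}; move: s1 b1 => s1; elim: n s1 => [|n IHn] s1 b1 /= H fg.
    by apply: fg => //; rewrite mul0n addn0.
  apply: (IH1 (iter n (safe E S c1) Q)) => // s2 H2 b2 le2.
  apply: IHn => // s3 Q3 b3 le3; apply: fg => //.
  have {}le2 : clock s2 <= clock s1 + D by move: le2; rewrite /D /=; lia.
  by apply: leq_trans le3 _; rewrite mulSn addnA leq_add2r.
- move=> /= [vS Qs] fg; apply: fg => //=; first exact: bounded_iset.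
  have := icost_le a bs; have := icost_le e bs.
  by have := bits_ival a bs; have := bits_ival e bs; lia.
- by move=> /= Qs fg; apply: fg => //=; rewrite /fcost -/T; lia.
- by move=> /= Qs fg; apply: fg => //=; rewrite /fcost -/T; lia.
- move=> /= Qs fg; congr (_ / _); apply: eq_bigr => t _.
  by apply: fg => //=; [apply: Qs|rewrite -/T; lia].
- move=> /= [Q0 Q1] fg; have := icost_le a bs; have := bits_ival a bs => ? ?.
  by rewrite !fg //=; try exact: bounded_iset; lia.
- move=> [eq /allP aS Qs] fg; apply: fg => //.
    move=> b; rewrite /iblock /=; case: ifP => // /andP[ab bb].
    by apply: aS; apply: mem_nth; rewrite ltn_subLR.
  have := icost_le a bs; have := icost_le e bs; rewrite /= [ival _ _]eq -/fac; lia.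
- move=> /= [vS Qs] fg; apply: fg => //=; first exact: bounded_iset.
  by have := icost_le a bs; rewrite /fcost -/T -/dl; lia.
- move=> /= Qs fg; apply: fg => //=.
  by have := icost_le e bs; have := bits_ival e bs; lia.
Qed.

End Time.

(* The clock can be ignored: the bound holds on every run. *)
Lemma prob_safe (F : finFieldType) (E : env F) S c (P Q : point F) N s :
    (0 < S)%N -> bounded S s -> safe E S c (fun=> True) (erase s) ->
    (clock s + clock_bound E S c <= N)%N ->
  prob E c (finds_path P Q N) s =
  pr E c (fun s' => (is_path P Q (output s'))%:R) (erase s).
Proof.
move=> S0 bs cs le; rewrite /prob.
rewrite -(expect_erase E c (fun s' => (is_path P Q (output s'))%:R)).
apply: (eq_expect_safe S0 bs cs) => s' _ _ le'.
by rewrite /finds_path (leq_trans le') // andbT.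
Qed.

(** * Polylogarithmic functions *)

Section Polylog.

Local Open Scope nat_scope.

Lemma polylog_le f g : (forall q, f q <= g q) -> polylog g -> polylog f.
Proof. by move=> fg [c [k H]]; exists c, k => q; apply: leq_trans (fg q) (H q). Qed.

Lemma polylog_cst n : polylog (fun=> n).
Proof. by exists n, 0 => q; rewrite muln1. Qed.

Lemma polylog_bits : polylog bits.
Proof. by exists 1, 1 => q; rewrite mul1n. Qed.

Lemma polylog_add f g : polylog f -> polylog g -> polylog (fun q => f q + g q).
Proof.
case=> [c [k fk]] [d [l gl]]; exists (c + d), (k + l) => q.
rewrite mulnDl leq_add //.
  by apply: leq_trans (fk q) _; rewrite leq_mul // leq_pexp2l ?leq_addr.
by apply: leq_trans (gl q) _; rewrite leq_mul // leq_pexp2l ?leq_addl.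
Qed.

Lemma polylog_mul f g : polylog f -> polylog g -> polylog (fun q => f q * g q).
Proof.
case=> [c [k fk]] [d [l gl]]; exists (c * d), (k + l) => q.
by rewrite expnD mulnACA leq_mul.
Qed.

Lemma polylog_exp f n : polylog f -> polylog (fun q => f q ^ n).
Proof.
move=> fp; elim: n => [|n IH]; first exact: (polylog_cst 1).
by apply: polylog_le (polylog_mul fp IH) => q; rewrite expnS.
Qed.

Lemma polylog_succ f : polylog f -> polylog (fun q => (f q).+1).
Proof.
move=> fp; apply: polylog_le (polylog_add fp (polylog_cst 1)) => q.
by rewrite addn1.
Qed.

Variables (S T : nat -> nat).
Hypotheses (pS : polylog S) (pT : polylog T).

Lemma polylog_ibits e : polylog (fun q => ibits (S q) e).
Proof. by elim: e => //= *; first [exact: polylog_cst|exact: polylog_add]. Qed.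

Lemma polylog_itime e : polylog (fun q => itime (S q) e).
Proof.
have pI := polylog_ibits.
by elim: e => /= *;
  do ?[exact: polylog_cst|exact: pS|apply: polylog_add|apply: polylog_exp].
Qed.

Lemma polylog_ctime c : polylog (fun q => ctime (S q) (T q) c).
Proof.
have pI := polylog_ibits; have pt := polylog_itime.
have pf n : polylog (fun q => n * T q).
  exact: polylog_mul (polylog_cst n) pT.
elim: c => [|c1 IH1 c2 IH2|[a b|a b] c1 IH1 c2 IH2|e c1 IH1|a e|x e|x e|x|a|a e
  |a g0 h|i e] /=;
  do ?[exact: pS|exact: pT|exact: pI|exact: pt|exact: pf|exact: IH1|exact: IH2
      |exact: polylog_cst|apply: polylog_succ|apply: polylog_add|apply: polylog_mul].
Qed.

End Polylog.

(** * Arithmetic *)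

Section Totient.

Local Open Scope nat_scope.

(** The i-th entry p_i of an increasing sequence above k is at least k + i, so p_i / (p_i - 1) <= (k
    + i) / (k + i - 1), and the product of these bounds telescopes. *)
Lemma prod_pred_increasing k l : 0 < k -> path ltn k l ->
  k * \prod_(p <- l) p <= (k + size l) * \prod_(p <- l) p.-1.
Proof.
elim: l k => [|p l IH] k k0 /=; first by rewrite !big_nil addn0.
case/andP=> kp pl; rewrite !big_cons.
have kl : path ltn k.+1 l.
  case: l pl {IH} => //= x l /andP[px ->]; rewrite andbT.
  by apply: leq_ltn_trans px.
have := IH k.+1 isT kl; rewrite addSnnS.
have : k * p <= k.+1 * p.-1 by nia.
move: (\prod_(_ <- l) _) (\prod_(_ <- l) _) (k + (size l).+1) => A B C h1 h2.
rewrite mulnA (leq_trans (leq_mul h1 (leqnn _))) //.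
by rewrite -mulnA mulnCA [leqRHS]mulnCA leq_mul2l h2 orbT.
Qed.

Lemma prod_primes n : 0 < n -> n = \prod_(p <- primes n) p ^ logn p n.
Proof. by move=> n0; rewrite [LHS]prod_prime_decomp // prime_decompE big_map. Qed.

Lemma size_primes_lt_bits n : 0 < n -> size (primes n) < bits n.
Proof.
move=> n0; rewrite ltnNge; apply/negP => le.
have s0 := leq_trans (bits_gt0 n) le.
have : n < 2 ^ size (primes n) by rewrite -bits_leP.
rewrite ltnNge => /negP; apply.
rewrite [leqRHS]prod_primes //.
have -> : 2 ^ size (primes n) = \prod_(p <- primes n) 2.
  by rewrite big_const_seq count_predT iter_muln_1.
rewrite big_seq [leqRHS]big_seq; apply: leq_prod => p.
rewrite mem_primes => /and3P[pp _ pn].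
apply: leq_trans (prime_gt1 pp) _; have lp : 0 < logn p n by rewrite logn_gt0 mem_primes pp n0.
by rewrite -[leqLHS]expn1; apply: leq_pexp2l lp; apply: prime_gt0.
Qed.

(** n / phi(n) is the product of p / (p - 1) over the primes of n, which by telescoping is at most 1
    plus their number. This is weaker than a log log bound, but elementary and sufficient. *)
Lemma totient_lower n : 0 < n -> n <= totient n * bits n.
Proof.
move=> n0; rewrite totientE // big_split /=.
have -> : \prod_(p <- primes n) p ^ (logn p n).-1 = n %/ \prod_(p <- primes n) p.
  rewrite [n in n %/ _]prod_primes //.
  have -> : \prod_(p <- primes n) p ^ logn p n =
            (\prod_(p <- primes n) p ^ (logn p n).-1) * \prod_(p <- primes n) p.
    rewrite -big_split /= big_seq [RHS]big_seq; apply: eq_bigr => p pn.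
    by rewrite -expnSr prednK // logn_gt0.
  rewrite mulnK // big_seq prodn_cond_gt0 // => p; rewrite mem_primes.
  by case/and3P=> /prime_gt0.
set A := \prod_(p <- _) p.-1; set B := \prod_(p <- _) p.
have B0 : 0 < B.
  by rewrite /B big_seq prodn_cond_gt0 // => p; rewrite mem_primes => /and3P[/prime_gt0].
have Bn : B %| n.
  rewrite [n in _ %| n]prod_primes // /B big_seq [X in _ %| X]big_seq.
  apply: (big_ind2 (fun x y => x %| y)) => // [x1 x2 y1 y2|p pn].
    exact: dvdn_mul.
  by rewrite dvdn_exp // logn_gt0.
have : B <= bits n * A.
  have pth : path ltn 1 (primes n).
    have : all (leq 2) (primes n).
      by apply/allP=> p; rewrite mem_primes => /and3P[/prime_gt1].
    by have := sorted_primes n; case: (primes n) => //= p l -> /andP[->].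
  have := prod_pred_increasing (isT : 0 < 1) pth; rewrite mul1n => /leq_trans; apply.
  by rewrite leq_mul2r add1n size_primes_lt_bits ?orbT.
move=> le; rewrite -{1}(divnK Bn); nia.
Qed.

End Totient.

(** * The Markoff surface *)

Section Field.

Variable F : finFieldType.
Implicit Types (a t u v x y z : F) (P Q : point F) (i j : 'I_3).

(** The form of being a generator that the program can evaluate: the order is a proper divisor of q
    - 1 exactly when it divides (q - 1) / p for some prime p dividing q - 1. *)
Definition genb x : bool :=
  (x != 0) && all (fun p => x ^+ (#|F|.-1 %/ p) != 1) (primes #|F|.-1).

Lemma card_pred_gt0 : (0 < #|F|.-1)%N.
Proof. by rewrite -subn1 subn_gt0 finNzRing_gt1. Qed.

Lemma val_unitX (w : {unit F}) n : FinRing.uval (w ^+ n)%g = FinRing.uval w ^+ n.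
Proof. by elim: n => [|n IH]; rewrite ?expgS ?exprS //= IH. Qed.

Lemma val_unit_neq0 (w : {unit F}) : FinRing.uval w != 0.
Proof. by rewrite -unitfE; apply: (valP w). Qed.

Lemma genb_unit (w : {unit F}) :
  generator [set: {unit F}] w = genb (FinRing.uval w).
Proof.
rewrite /genb val_unit_neq0 /= -card_finField_unit.
set n := #|_|.
have ordn : (#[w]%g %| n)%N by apply: order_dvdG; rewrite inE.
have n0 : (0 < n)%N by apply: cardG_gt0.
have -> : generator [set: {unit F}] w = (#[w]%g == n).
  rewrite /generator; apply/eqP/eqP => [e|e]; first by rewrite /n e.
  apply/eqP; rewrite eq_sym eqEcard subsetT; exact: eq_leq.
have X1 k : (FinRing.uval w ^+ k == 1) = (#[w]%g %| k)%N.
  by rewrite order_dvdn -val_unitX; apply/eqP/eqP => [H|->] //; apply: val_inj.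
apply/eqP/allP => [e p|H].
  rewrite mem_primes X1 => /and3P[pp _ pn]; apply/negP => /dvdn_leq.
  rewrite e divn_gt0 ?prime_gt0 // (dvdn_leq n0 pn) => /(_ isT).
  by rewrite leqNgt ltn_Pdiv ?prime_gt1.
apply/eqP; apply: contraT => ne.
have [p pp pd] : {p | prime p & p %| n %/ #[w]%g}%N.
  apply: pdivP; rewrite ltn_neqAle divn_gt0 ?order_gt0 // (dvdn_leq n0 ordn) andbT.
  by apply: contra ne => /eqP e; rewrite -(divnK ordn) -e mul1n.
have pn : (p %| n)%N by apply: dvdn_trans pd (dvdn_div ordn).
have := H p; rewrite mem_primes pp n0 pn => /(_ isT); rewrite X1.
rewrite -{1}(divnK ordn) -{1}(divnK pd) mulnAC mulnK ?prime_gt0 //.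
by rewrite dvdn_mull.
Qed.

(** The roots of T^2 - 3tT + 1 are inverse to each other, so it is enough to test either one. *)
Lemma genbV x : genb x -> genb x^-1.
Proof.
case/andP=> x0 /allP H; rewrite /genb invr_eq0 x0 /=.
apply/allP=> p /H; apply: contra => /eqP e.
by rewrite -[x]invrK exprVn e invr1.
Qed.

Hypothesis charF : forall p : nat, p \in [pchar F] -> (5 <= p)%N.

Lemma neq0_2 : 2 != 0 :> F.
Proof.
by apply/negP => /eqP e; have := @charF 2; rewrite !inE e eqxx /= => /(_ isT).
Qed.

Lemma neq0_3 : 3 != 0 :> F.
Proof.
by apply/negP => /eqP e; have := @charF 3; rewrite !inE e eqxx /= => /(_ isT).
Qed.

Lemma neq0_4 : 4 != 0 :> F.
Proof. by rewrite (_ : 4 = 2 * 2) ?mulf_neq0 ?neq0_2 // -natrM. Qed.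

Lemma card_ge5 : (5 <= #|F|)%N.
Proof.
have: uniq [:: 0; 1; 2; 3; 4 : F].
  have ne (m n : nat) : (m < n)%N -> (n - m)%:R != 0 :> F -> (m%:R == n%:R :> F) = false.
    by move=> mn; rewrite natrB 1?ltnW // subr_eq0 eq_sym => /negbTE.
  rewrite /= !inE -[0]/(0%:R) -[1]/(1%:R).
  by rewrite !ne ?neq0_2 ?neq0_3 ?neq0_4 ?oner_eq0.
by move/card_uniqP => e; rewrite -[5%N]/(size [:: 0; 1; 2; 3; 4 : F]) -e max_card.
Qed.

(** A generator has order q - 1 >= 4. Hence the eigenvalues l and 1/l are distinct. *)
Lemma genb_sq_neq1 x : genb x -> x ^+ 2 != 1.
Proof.
move=> gx; have /andP[x0 _] := gx; have Ux : x \is a GRing.unit by rewrite unitfE.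
have := gx; rewrite -[x]/(FinRing.uval (FinRing.unit F Ux)) -genb_unit.
rewrite /generator => /eqP gU; apply/negP => /eqP e.
have : (#[FinRing.unit F Ux]%g %| 2)%N.
  by rewrite order_dvdn; apply/eqP/val_inj; apply: etrans (val_unitX _ _) e.
move/dvdn_leq => /(_ isT); rewrite orderE -gU card_finField_unit.
by have := card_ge5; lia.
Qed.

Lemma char_root t x :
  root ('X^2 - (3 * t) *: 'X + 1) x = (x != 0) && (x + x^-1 == 3 * t).
Proof.
rewrite /root !hornerE; have [->|x0] /= := eqVneq x 0.
  by rewrite expr0n mulr0 subrr add0r oner_eq0.
apply/eqP/eqP => [e|<-]; last by field.
have /eqP : x * (x + x^-1 - 3 * t) = 0 by rewrite -e; field.
by rewrite mulf_eq0 (negbTE x0) subr_eq0 => /eqP.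
Qed.

Lemma max_hyp_ex t : max_hyp t -> t != 0 /\ exists l, genb l /\ l + l^-1 = 3 * t.
Proof.
case/andP=> t0 /existsP[w /andP[]]; rewrite genb_unit char_root => gw /andP[_ /eqP].
by split=> //; exists (FinRing.uval w).
Qed.

Lemma max_hyp_root l t : l != 0 -> l + l^-1 = 3 * t ->
  max_hyp t = (t != 0) && genb l.
Proof.
move=> l0 lt; rewrite /max_hyp; case: (t != 0) => //=.
apply/existsP/idP => [[w]|gl].
  rewrite genb_unit char_root => /andP[gw /andP[w0 /eqP wt]].
  have : (FinRing.uval w - l) * (FinRing.uval w - l^-1) = 0.
    have : FinRing.uval w * (FinRing.uval w + (FinRing.uval w)^-1)
           = FinRing.uval w * (l + l^-1) by rewrite wt lt.
    rewrite mulrDr mulfV // => e; move: (FinRing.uval w) e => x e.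
    have -> : (x - l) * (x - l^-1) = x * x + 1 - x * (l + l^-1) by field.
    by rewrite e subrr.
  move/eqP; rewrite mulf_eq0 !subr_eq0 => /orP[] /eqP e; first by rewrite -e.
  by rewrite -[l]invrK -e; apply: genbV.
have Ul : l \is a GRing.unit by rewrite unitfE.
by exists (FinRing.unit F Ul); rewrite genb_unit gl char_root l0 /= lt eqxx.
Qed.

Lemma max_hyp_disc t : max_hyp t -> exists s, s ^+ 2 = (3 * t) ^+ 2 - 4.
Proof.
case/max_hyp_ex=> _ [l [/andP[l0 _] <-]]; exists (l - l^-1).
by rewrite !expr2; field.
Qed.

Lemma quad_root s t : s ^+ 2 = (3 * t) ^+ 2 - 4 ->
  (3 * t + s) / 2 != 0 /\ (3 * t + s) / 2 + ((3 * t + s) / 2)^-1 = 3 * t.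
Proof.
move=> e; have n2 := neq0_2.
have e1 : ((3 * t + s) / 2) * ((3 * t - s) / 2) = 1.
  have -> : ((3 * t + s) / 2) * ((3 * t - s) / 2) = ((3 * t) ^+ 2 - s ^+ 2) / 4.
    by field; rewrite n2 neq0_4.
  by rewrite e; field; rewrite neq0_4.
have l0 : (3 * t + s) / 2 != 0.
  by apply: contra_eqN e1 => /eqP ->; rewrite mul0r eq_sym oner_eq0.
split=> //; have -> : ((3 * t + s) / 2)^-1 = (3 * t - s) / 2.
  by apply: (mulfI l0); rewrite mulfV // e1.
by field.
Qed.

Lemma max_hyp_test s t : s ^+ 2 = (3 * t) ^+ 2 - 4 ->
  max_hyp t = (t != 0) && genb ((3 * t + s) / 2).
Proof. by case/quad_root; apply: max_hyp_root. Qed.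

(** The two other coordinates are ordered so that rho_i is (u, v) |-> (3au - v, u) for every i. *)
Definition pt i a u v : point F :=
  match val i with 0 => (a, v, u) | 1 => (u, a, v) | _ => (v, u, a) end.

Lemma rot_pt i a u v : rot i (pt i a u v) = pt i a (3 * a * u - v) u.
Proof.
case: i => [[|[|[|i]]] ltn] //=; rewrite /rot /pt /=; repeat congr (_, _); ring.
Qed.

Lemma Mstar_pt i a u v : Mstar (pt i a u v) = 
  ((u, v, a) != (0, 0, 0)) && (u ^+ 2 + v ^+ 2 + a ^+ 2 == 3 * a * u * v).
Proof.
rewrite /Mstar /pt; case: i => [[|[|[|i]]] ltn] //=; rewrite !xpair_eqE; congr (~~ _ && _).
- by case: (u == 0); case: (v == 0); case: (a == 0).
- by congr (_ == _); ring.
- by case: (u == 0); case: (v == 0); case: (a == 0).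
- by congr (_ == _); ring.
- by case: (u == 0); case: (v == 0); case: (a == 0).
- by congr (_ == _); ring.
Qed.

Lemma pt_surj i P : exists u v, P = pt i (coord i P) u v.
Proof.
case: P => [[x y] z]; case: i => [[|[|[|i]]] ltn] //=; rewrite /pt /=.
- by exists z, y.
- by exists x, z.
- by exists y, x.
Qed.

Lemma Mstar_rot i P : Mstar P -> Mstar (rot i P).
Proof.
have [u [v ->]] := pt_surj i P; move: (coord i P) => a.
rewrite rot_pt !Mstar_pt => /andP[ne /eqP e]; apply/andP; split.
  apply: contra ne; rewrite !xpair_eqE => /andP[/andP[h /eqP u0] /eqP a0].
  by move: h; rewrite u0 a0 mulr0 sub0r oppr_eq0 => ->; rewrite eqxx.
apply/eqP; transitivity (9 * a ^+ 2 * u ^+ 2 - 6 * a * u * v + (u ^+ 2 + v ^+ 2 + a ^+ 2)).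
  by ring.
by rewrite e; ring.
Qed.

Lemma Mstar_word P w : Mstar P -> Mstar (apply_word P w).
Proof. by elim: w P => //= i w IH P /(Mstar_rot i)/IH. Qed.

Lemma path_trace P w : Mstar P -> path (@edge F) P (trace P w).
Proof.
elim: w P => //= i w IH P MP; rewrite /edge MP Mstar_rot //=.
rewrite IH ?Mstar_rot // andbT; apply/existsP; exists i.
by rewrite eqxx.
Qed.

Lemma is_path_word P Q w : Mstar P -> apply_word P (expand w) = Q -> is_path P Q w.
Proof. by move=> MP <-; rewrite /is_path path_trace //=. Qed.

Lemma apply_word_cat P w1 w2 :
  apply_word P (w1 ++ w2) = apply_word (apply_word P w1) w2.
Proof. exact: foldl_cat. Qed.

Lemma expand_cat w1 w2 : expand (w1 ++ w2) = expand w1 ++ expand w2.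
Proof. by rewrite /expand map_cat flatten_cat. Qed.

Lemma apply_word_nseq P i n : apply_word P (nseq n i) = iter n (rot i) P.
Proof.
by elim: n P => // n IH P; rewrite iterSr -IH.
Qed.

(* On the conic of points with i-th coordinate a, rho_i multiplies the linear
   form u - v / l by l, and its conjugate u - l v is determined by their
   product - a ^ 2. *)
Lemma rot_form i a l u v n : l != 0 -> l + l^-1 = 3 * a -> exists u' v',
  iter n (rot i) (pt i a u v) = pt i a u' v' /\ u' - l^-1 * v' = l ^+ n * (u - l^-1 * v).
Proof.
move=> l0 la; elim: n => [|n [u' [v' [e1 e2]]]].
  by exists u, v; rewrite expr0 mul1r.
exists (3 * a * u' - v'), u'; rewrite iterS e1 rot_pt; split=> //.
by rewrite exprS -[RHS]mulrA -e2 -la; field.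
Qed.

Lemma form_neq0 i a l u v : l != 0 -> l + l^-1 = 3 * a -> a != 0 ->
  Mstar (pt i a u v) -> u - l^-1 * v != 0.
Proof.
move=> l0 la a0; rewrite Mstar_pt => /andP[_ /eqP e]; apply/negP => /eqP f0.
have : (u - l^-1 * v) * (u - l * v) = - a ^+ 2.
  transitivity (u ^+ 2 + v ^+ 2 - (l + l^-1) * u * v); first by field.
  by rewrite la -e; ring.
by rewrite f0 mul0r => /eqP; rewrite eq_sym oppr_eq0 expf_eq0 (negbTE a0).
Qed.

(** The form u - v / l agrees at the two points and is nonzero, so the conjugate forms agree as
    well, the products being - a^2. As l^2 is not 1, the two forms are independent and determine the
    point. *)
Lemma link i a l u v u' v' n : genb l -> l + l^-1 = 3 * a -> a != 0 ->
    Mstar (pt i a u v) -> Mstar (pt i a u' v') ->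
    u' - l^-1 * v' = l ^+ n * (u - l^-1 * v) ->
  iter n (rot i) (pt i a u v) = pt i a u' v'.
Proof.
move=> gl la a0 M M' e; have /andP[l0 _] := gl.
have [x [y [e1 e2]]] := rot_form i u v n l0 la.
have M1 : Mstar (pt i a x y).
  by rewrite -e1; elim: n {e e1 e2} => //= n; apply: Mstar_rot.
rewrite e1; rewrite -e in e2.
have conj u1 v1 : Mstar (pt i a u1 v1) -> (u1 - l^-1 * v1) * (u1 - l * v1) = - a ^+ 2.
  rewrite Mstar_pt => /andP[_ /eqP e'].
  transitivity (u1 ^+ 2 + v1 ^+ 2 - (l + l^-1) * u1 * v1); first by field.
  by rewrite la -e'; ring.
have e3 : x - l * y = u' - l * v'.
  apply: (mulfI (form_neq0 l0 la a0 M')).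
  by rewrite -{1}e2 !conj.
have ev : y = v'.
  apply/eqP; rewrite -subr_eq0; have /eqP : (l ^+ 2 - 1) * (y - v') = 0.
    transitivity (l * ((x - l^-1 * y) - (u' - l^-1 * v') - ((x - l * y) - (u' - l * v')))).
      by field.
    by rewrite e2 e3 !subrr mulr0.
  by rewrite mulf_eq0 (subr_eq0 _ 1) (negbTE (genb_sq_neq1 gl)).
by move: e3; rewrite ev => /addIr ->.
Qed.

(** For fixed a, rho_i acts on (u, v) by the matrix with rows (3a, -1) and (1, 0), of determinant 1.
    Lagrange's theorem in GL_2(F_q), of order q (q - 1)^2 (q + 1), gives an exponent that does not
    depend on a. *)
Lemma rot_order i P : iter (#|F| * #|F|.-1 ^ 2 * #|F|.+1) (rot i) P = P.
Proof.
have [u [v ->]] := pt_surj i P; move: (coord i P) => a {P}.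
rewrite -card_GL_2; set N := #|_|.
pose A : 'M[F]_2 := \matrix_(j < 2, k < 2)
  if j == 0 then (if k == 0 then 3 * a else -1) else (k == 0)%:R.
pose V (x y : F) : 'cV[F]_2 := \col_(j < 2) if j == 0 then x else y.
have AV x y : A *m V x y = V (3 * a * x - y) x.
  apply/colP => j; rewrite !mxE big_ord_recl big_ord1 !mxE /= .
  by case: eqP => _; rewrite ?mul1r ?mul0r ?mulN1r ?addr0.
have UA : A \is a GRing.unit.
  rewrite -[_ \is a _]/(A \in unitmx) unitmxE.
  rewrite (expand_det_row _ 0) big_ord_recl big_ord1 /cofactor !det_mx11 !mxE /=.
  by rewrite /bump /= addn0 expr1 !mulr0 add0r mulr1 mulN1r opprK unitr1.
have AN : A ^+ N = 1.
  pose g : {'GL_2[F]} := FinRing.unit _ UA.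
  have gX n : GLval (g ^+ n)%g = A ^+ n.
    by elim: n => [|n IH]; rewrite ?expgS ?exprS // -IH.
  by rewrite -gX expg_cardG ?inE.
have AnV n x y : exists x' y', iter n (rot i) (pt i a x y) = pt i a x' y' /\
    A ^+ n *m V x y = V x' y'.
  elim: n => [|n [x' [y' [e1 e2]]]]; first by exists x, y; rewrite expr0 mul1mx.
  exists (3 * a * x' - y'), x'; rewrite iterS e1 rot_pt; split=> //.
  by rewrite exprS -mulmxA e2 AV.
have [x [y [-> ]]] := AnV N u v; rewrite AN mul1mx => /colP e.
by have := e 0; have := e 1; rewrite !mxE /= => -> ->.
Qed.

Lemma rotK i P : iter (#|F| * #|F|.-1 ^ 2 * #|F|.+1).-1 (rot i) (rot i P) = P.
Proof.
rewrite -iterSr prednK ?rot_order //.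
by have := card_pred_gt0; have := card_ge5; nia.
Qed.

End Field.

(** * Random words *)

Section Words.

Variables (F : finFieldType) (j l0 l1 : 'I_3).
Hypothesis lettersE : forall i, (i != j) = (i == l0) || (i == l1).
Hypothesis letters_neq : l0 != l1.

Definition letter (b : bool) : 'I_3 := if b then l1 else l0.

(** The number of words that lead from P into A, in the recursive form that the coin flips of the
    program follow. *)
Fixpoint wcount (A : pred (point F)) (n : nat) (P : point F) : nat :=
  if n is n'.+1 then wcount A n' (rot l0 P) + wcount A n' (rot l1 P) else A P.

Lemma sum_tuple_cons (f : seq 'I_3 -> nat) n :
  (\sum_(w : n.+1.-tuple 'I_3) f w = \sum_(i : 'I_3) \sum_(w : n.-tuple 'I_3) f (i :: w))%N.
Proof.
rewrite (pair_big xpredT xpredT) /=.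
rewrite (reindex (fun p : 'I_3 * n.-tuple 'I_3 => cons_tuple p.1 p.2)) //=.
exists (fun w => (thead w, behead_tuple w)) => [[i w]|w] _ /=.
  by congr (_, _); apply: val_inj.
by rewrite [RHS]tuple_eta; apply: val_inj.
Qed.

Lemma card_words (A : pred (point F)) n P :
  #|[set w : n.-tuple 'I_3 | all (predC1 j) w & A (apply_word P w)]| = wcount A n P.
Proof.
have toSum m R : #|[set w : m.-tuple 'I_3 | all (predC1 j) w & A (apply_word R w)]| =
    (\sum_(w : m.-tuple 'I_3) (all (predC1 j) w && A (apply_word R w)))%N.
  by rewrite -sum1_card big_mkcond; apply: eq_bigr => w _; rewrite inE; case: (_ && _).
elim: n P => [|n IH] P.
  by rewrite toSum (big_pred1 [tuple]) //= => w; apply/esym/eqP; apply: tuple0.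
rewrite toSum (sum_tuple_cons (fun w => all (predC1 j) w && A (apply_word P w) : nat)).
(* Words that begin with the excluded letter contribute 0. *)
rewrite (bigID (predC1 j)) /= [X in (_ + X)%N]big1 ?addn0; last first.
  by move=> i ij; rewrite big1 // => w _; rewrite (negbTE ij).
under eq_bigl => i do rewrite lettersE.
rewrite (bigD1 l0) /= ?eqxx // (big_pred1 l1) /=; last first.
  move=> i /=; have [->|] := eqVneq i l0; last by rewrite andbT.
  by rewrite andbF (negbTE letters_neq).
rewrite !lettersE !eqxx orbT /=.
by rewrite -!IH !toSum.
Qed.

Lemma wcountT n P : wcount xpredT n P = (2 ^ n)%N.
Proof. by elim: n P => //= n IH P; rewrite !IH addnn -mul2n expnS. Qed.

Lemma walk_probE n P :
  walk_prob n j P = (wcount (fun R => max_hyp (coord j R)) n P)%:R / 2 ^+ n.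
Proof.
rewrite /walk_prob (card_words (fun R => max_hyp (coord j R)) n P); congr (_ / _).
rewrite -natrX -(wcountT n P) -card_words; congr _%:R.
by apply: eq_card => w; rewrite !inE andbT.
Qed.

End Words.

(** Least significant digit first: a letter is pushed by V |-> 2V + b, so the most recent one
    leads. *)
Fixpoint low_bits (n V : nat) : seq bool :=
  if n is n'.+1 then odd V :: low_bits n' (V %/ 2) else [::].

Lemma low_bits_push n V (b : bool) :
  low_bits n.+1 (2 * V + b) = b :: low_bits n V.
Proof.
rewrite /= oddD oddM /= oddb; congr (_ :: low_bits _ _).
by rewrite divnDl ?dvdn_mulr // mulKn // divn_small ?addn0 //; case: b.
Qed.

Lemma push_lt n V (b : bool) : (V < 2 ^ n -> 2 * V + b < 2 ^ n.+1)%N.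
Proof. by rewrite expnS; case: b => /=; lia. Qed.

(** * The program *)

Notation cell a := (ICell (IConst a)).
Notation prog := (foldr Seq Skip).

Definition F3 : fexp := FAdd FOne (FAdd FOne FOne).
Definition F2 : fexp := FAdd FOne FOne.
Definition F4 : fexp := FMul F2 F2.
Definition FSub (a b : fexp) : fexp := FAdd a (FOpp b).
Definition FDiv (a b : fexp) : fexp := FMul a (FInv b).
Definition FSq (a : fexp) : fexp := FMul a a.

(* Cells 0 to 3 hold q, the length of the walks, the number of bits of q and
   the number of trials; the factorization of q - 1 is stored from cell 100. *)

Definition pow_cmd : cmd :=
  prog [:: FSet 22 (FReg 21); FSet 23 FOne;
    For (cell 2) (prog [::
      If (BILe (IConst 1) (IMod (cell 21) (IConst 2)))
         (FSet 23 (FMul (FReg 23) (FReg 22))) Skip;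
      FSet 22 (FMul (FReg 22) (FReg 22));
      ISet (IConst 21) (IDiv (cell 21) (IConst 2))])].

(** Primes and exponents alternate after cell 100, so the i-th prime, from i = 0, is in cell 101 +
    2i. A failed test clears cell 20, and nothing sets it again. *)
Definition generator_cmd : cmd :=
  prog [:: ISet (IConst 22) (IConst 0);
    For (cell 100) (prog [::
      ISet (IConst 21) (IDiv (ISub (cell 0) (IConst 1))
        (ICell (IAdd (IConst 101) (IMul (IConst 2) (cell 22)))));
      pow_cmd;
      If (BFEq (FReg 23) FOne) (ISet (IConst 20) (IConst 0)) Skip;
      ISet (IConst 22) (IAdd (cell 22) (IConst 1))])].

Definition disc_exp : fexp := FSub (FSq (FMul F3 (FReg 20))) F4.

(* Tests whether register 20 is maximally hyperbolic; the answer is left in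
   cell 20 and the eigenvalue in register 21. *)
Definition max_hyp_cmd : cmd :=
  prog [:: FSqrt 24 disc_exp;
    FSet 21 (FDiv (FAdd (FMul F3 (FReg 20)) (FReg 24)) F2);
    If (BFEq (FSq (FReg 24)) disc_exp)
      (prog [:: If (BFEq (FReg 20) FZero) (ISet (IConst 20) (IConst 0))
                   (ISet (IConst 20) (IConst 1));
              generator_cmd])
      (ISet (IConst 20) (IConst 0))].

(** In the notation of [pt], the offsets of a, u, v are i, i + 2 and i + 1 modulo 3. *)
Definition rot_cmd (i : 'I_3) (d : nat) : cmd :=
  let a := (d + i)%N in
  let u := (d + (i + 2) %% 3)%N in
  let v := (d + (i + 1) %% 3)%N in
  prog [:: FSet 30 (FSub (FMul (FMul F3 (FReg a)) (FReg u)) (FReg v));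
    FSet v (FReg u); FSet u (FReg 30)].

Definition walk_step (l0 l1 : 'I_3) (d code : nat) : cmd :=
  prog [:: Flip (IConst 10);
    ISet (IConst code) (IAdd (IMul (IConst 2) (cell code)) (cell 10));
    If (BILe (IConst 1) (cell 10)) (rot_cmd l1 d) (rot_cmd l0 d)].

(** The walk moves a copy of the point in [src], from which later trials start afresh. *)
Definition walk_trial (j l0 l1 : 'I_3) (src d code lam found : nat) : cmd :=
  prog [:: FSet d (FReg src); FSet d.+1 (FReg src.+1); FSet d.+2 (FReg src.+2);
    ISet (IConst code) (IConst 0);
    For (cell 1) (walk_step l0 l1 d code);
    FSet 20 (FReg (d + j)); max_hyp_cmd; FSet lam (FReg 21);
    ISet (IConst found) (cell 20)].

(** The discriminant of F(t, a, Z) as a quadratic polynomial in Z. *)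
Definition conic_disc (a t : fexp) : fexp :=
  FSub (FSq (FMul (FMul F3 t) a)) (FMul F4 (FAdd (FSq t) (FSq a))).

Definition conic_root (a t s : fexp) : fexp := FDiv (FAdd (FMul (FMul F3 t) a) s) F2.

(** Register 7 holds the y-coordinate reached from P, register 11 the z-coordinate reached from Q.
    The square root of a non-square is arbitrary, so each root is squared again before it is
    trusted. *)
Definition curve_trial : cmd :=
  prog [:: FRand 15; FSet 20 (FReg 15); max_hyp_cmd; FSet 14 (FReg 21);
    FSqrt 18 (conic_disc (FReg 7) (FReg 15));
    FSqrt 19 (conic_disc (FReg 11) (FReg 15));
    FSet 16 (conic_root (FReg 7) (FReg 15) (FReg 18));
    FSet 17 (conic_root (FReg 11) (FReg 15) (FReg 19));
    If (BFEq (FSq (FReg 18)) (conic_disc (FReg 7) (FReg 15)))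
      (If (BFEq (FSq (FReg 19)) (conic_disc (FReg 11) (FReg 15)))
        (ISet (IConst 6) (cell 20)) Skip) Skip].

(** * Correctness of the arithmetic subprograms *)

Section Specs.

Variables (F : finFieldType) (E : env F) (S n N : nat).
Hypothesis charF : forall p : nat, p \in [pchar F] -> (5 <= p)%N.
Hypothesis corE : correct_env E.
Hypothesis LS : (bits #|F| < S)%N.

Implicit Types (s : state F).

Local Notation safe := (safe E S).

Lemma S_pos : (0 < S)%N. Proof. exact: leq_ltn_trans LS. Qed.

Lemma bits_small k v : (k <= S)%N -> (v < 2 ^ k)%N -> (bits v <= S)%N.
Proof.
by move=> kS vk; rewrite bits_leP ?S_pos // (leq_trans vk) // leq_exp2l.
Qed.

Lemma bits_le_card v : (v <= #|F|)%N -> (bits v <= S)%N.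
Proof. by move=> vq; apply: leq_trans (leq_bits vq) (ltnW LS). Qed.

Lemma safe_seq c1 c2 Q s : safe c1 (safe c2 Q) s -> safe (Seq c1 c2) Q s.
Proof. by []. Qed.

Lemma safe_FSet x e c Q s :
  safe c Q (fset x (fval (freg s) e) s) -> safe (Seq (FSet x e) c) Q s.
Proof. by []. Qed.

Lemma safe_ISet a e c Q s : (bits (ival (imem s) e) <= S)%N ->
  safe c Q (iset a (ival (imem s) e) s) -> safe (Seq (ISet (IConst a) e) c) Q s.
Proof. by []. Qed.

Lemma safe_FSqrt x e c Q s :
  safe c Q (fset x (sqrt_of E (fval (freg s) e)) s) -> safe (Seq (FSqrt x e) c) Q s.
Proof. by []. Qed.

Lemma safe_if b c1 c2 Q s : (bval s b -> safe c1 Q s) -> (~~ bval s b -> safe c2 Q s) ->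
  safe (If b c1 c2) Q s.
Proof. by move=> H1 H2 /=; case: ifP => [/H1|/negbT/H2]. Qed.

(** The data left by the prologue, which the rest of the program reads and never overwrites. *)
Definition ctx s : Prop :=
  [/\ imem s 0 = #|F|, imem s 1 = n, imem s 2 = bits #|F|, imem s 3 = N
    & imem s 100 = size (primes #|F|.-1) /\
      forall i, (i < size (primes #|F|.-1))%N ->
        imem s (101 + 2 * i)%N = nth 0%N (primes #|F|.-1) i].

Lemma ctx_agree w A B s s' : agree w A B s s' -> all (fun a => 3 < a < 100)%N A ->
  ctx s -> ctx s'.
Proof.
case=> _ m _ /allP HA [c0 c1 c2 c3 [c4 c5]].
have nA a : ~~ (3 < a < 100)%N -> imem s' a = imem s a.
  by move=> na; apply: m; apply: contra na; apply: HA.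
by rewrite /ctx !nA //; split=> //; split=> // i /c5 <-; apply: nA; clear LS; lia.
Qed.

Lemma pow_cmdP s : imem s 2 = bits #|F| -> (imem s 21 <= #|F|)%N ->
  safe pow_cmd (fun s' => freg s' 23 = freg s 21 ^+ imem s 21) s.
Proof.
move=> c2 eq.
(* Square and multiply: accumulator times base to the remaining exponent is constant, and that
   exponent has at most k binary digits when k iterations remain. *)
pose I k s' := (imem s' 21 < 2 ^ k)%N /\
  freg s' 23 * freg s' 22 ^+ imem s' 21 = freg s 21 ^+ imem s 21.
do 2!apply: safe_FSet; apply: safe_seq; apply: (@safe_loop _ _ _ I) => /=; rewrite ?c2.
- exact: ltnW.
- split=> /=; first by apply: leq_ltn_trans eq (ltn_bits _).
  by rewrite mul1r.
- move=> k s' kL [lt e]; rewrite /I /=.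
  have bd : (bits (imem s' 21 %/ 2) <= S)%N.
    apply: (@bits_small k); first by apply: ltnW; apply: ltn_trans LS.
    by rewrite ltn_divLR // mulnC -expnS.
  have lt' : (imem s' 21 %/ 2 < 2 ^ k)%N by rewrite ltn_divLR // mulnC -expnS.
  have eE : freg s' 22 ^+ imem s' 21 = (freg s' 22 * freg s' 22) ^+ (imem s' 21 %/ 2)
      * freg s' 22 ^+ (imem s' 21 %% 2).
    by rewrite {1}(divn_eq (imem s' 21) 2) exprD mulnC exprM expr2.
  rewrite -e eE => {e eE}; have h2 := ltn_pmod (imem s' 21) (isT : 0 < 2)%N.
  case: ltnP => h; split=> //; split=> //=.
    have -> : (imem s' 21 %% 2 = 1)%N by lia.
    by rewrite expr1 -mulrA [freg s' 22 * _]mulrC.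
  have -> : (imem s' 21 %% 2 = 0)%N by lia.
  by rewrite mulr1.
- by move=> s' [] /[!expn0] /[!ltnS] /[!leqn0] /eqP -> /[!expr0] /[!mulr1].
Qed.

Lemma generator_cmdP (b : bool) s : ctx s -> imem s 20 = b ->
  safe generator_cmd (fun s' => imem s' 20 = b &&
    all (fun p => freg s 21 ^+ (#|F|.-1 %/ p) != 1) (primes #|F|.-1) :> nat) s.
Proof.
move=> cs b0; set l := freg s 21; set ps := primes _.
pose ok p := l ^+ (#|F|.-1 %/ p) != 1.
pose A := [:: 20; 21; 22]%N; pose B := [:: 22; 23]%N.
pose I k s' := [/\ imem s' 22 = (size ps - k)%N,
  imem s' 20 = b && all ok (take (size ps - k) ps) :> nat & agree false A B s s'].
have sq : (size ps <= #|F|)%N.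
  apply: leq_trans (ltnW (size_primes_lt_bits (card_pred_gt0 F))) _.
  apply: leq_trans (bits_le (card_pred_gt0 F)) _; lia.
have [_ _ _ _ [c100 _]] := cs.
apply: safe_ISet; first exact: bits_le_card.
apply: safe_seq; apply: (@safe_loop _ _ _ I); rewrite -/ps //.
- rewrite [ival _ _]c100; apply: ltnW; apply: leq_trans (size_primes_lt_bits (card_pred_gt0 F)) _.
  by apply: leq_trans (ltnW LS); apply: leq_bits; lia.
- rewrite [ival _ _]c100 -/ps; split; rewrite ?subnn ?take0 ?andbT //.
  exact: agree_iset.
- rewrite [ival _ _]c100 -/ps => k s' kp [i22 i20 ag].
  have cs' := ctx_agree ag isT cs.
  have [q0 _ L2 _ [_ pi]] := cs'.
  have lt : (size ps - k.+1 < size ps)%N by lia.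
  have pi' := pi _ lt.
  set p := nth 0%N ps (size ps - k.+1) in pi'.
  have Ep : ((#|F| - 1) %/ p = #|F|.-1 %/ p)%N by rewrite subn1.
  have pq : (#|F|.-1 %/ p <= #|F|)%N by apply: leq_trans (leq_div _ _) _; lia.
  have ev : ival (imem s') (IDiv (ISub (cell 0) (IConst 1))
        (ICell (IAdd (IConst 101) (IMul (IConst 2) (cell 22))))) = (#|F|.-1 %/ p)%N.
    by rewrite /= i22 pi' q0 Ep.
  apply: safe_ISet; rewrite ev; first exact: bits_le_card.
  apply: safe_seq; set s1 := iset _ _ _.
  have c21 : imem s1 21 = (#|F|.-1 %/ p)%N by [].
  have H := @pow_cmdP s1 L2 pq.
  apply: safe_mono (safe_frame (w := false) H isT) => s2 [].
  rewrite c21 /= -/s1 => e23 ag2.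
  have ag' : agree false A B s s2.
    apply: agree_trans ag _; apply: (@agree_trans _ _ _ _ _ s1); first exact: agree_iset.
    by apply: agree_sub ag2 => a; rewrite !inE; do ?case/orP; move/eqP ->.
  have [_ m2 _] := ag2.
  have l1 : freg s1 21 = l by case: ag => _ _ r; apply: r.
  rewrite l1 in e23.
  have tk : take (size ps - k) ps = rcons (take (size ps - k.+1) ps) p.
    by rewrite (_ : (size ps - k)%N = (size ps - k.+1).+1) ?(take_nth 0%N) //; lia.
  have okp : ok p = (freg s2 23 != 1) by rewrite /ok e23.
  have c22 : imem s2 22 = (size ps - k.+1)%N by rewrite m2.
  have c20 : imem s2 20 = b && all ok (take (size ps - k.+1) ps) :> nat by rewrite m2.
  rewrite /I tk all_rcons okp; case: eqP => /= _; rewrite c22.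
    split; first exact: bits_le_card.
    split; first by apply: bits_le_card; lia.
    split=> /=; [lia|by rewrite andbF|].
    apply: agree_trans ag' _; apply: (@agree_trans _ _ _ _ _ (iset 20 0%N s2));
      exact: agree_iset.
  split; first by apply: bits_le_card; lia.
  split=> /=; [lia|by rewrite c20|].
  by apply: agree_trans ag' _; apply: agree_iset.
- by move=> s' [_ e _] /=; rewrite e subn0 take_size.
Qed.

Lemma fval4 (r : nat -> F) : fval r F4 = 4.
Proof. by rewrite /= -[1 + 1]/(2%:R) -natrM. Qed.

Definition eigen (l t : F) : Prop := genb l /\ l + l^-1 = 3 * t.

Lemma max_hyp_cmdP s : ctx s ->
  safe max_hyp_cmd (fun s' => imem s' 20 = max_hyp (freg s 20) :> nat /\
    (max_hyp (freg s 20) -> eigen (freg s' 21) (freg s 20))) s.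
Proof.
move=> cs; set t := freg s 20.
apply: safe_FSqrt; apply: safe_FSet; apply: safe_seq.
set d := fval (freg s) disc_exp.
have dE : d = (3 * t) ^+ 2 - 4 by rewrite /d expr2 -(fval4 (freg s)).
set sq := sqrt_of E d; set l := fval _ _; set s1 := fset 21 l _.
have lE : l = (3 * t + sq) / 2 by [].
have dE1 : fval (freg s1) disc_exp = d by [].
have cs1 : ctx s1 by [].
apply: safe_if; rewrite /bval dE1 [fval _ _]/= -/sq => sqd.
  have sqE : sq ^+ 2 = (3 * t) ^+ 2 - 4 by rewrite -dE; apply/eqP; rewrite expr2.
  have mE : max_hyp t = (t != 0) && genb l by rewrite lE; apply: max_hyp_test.
  apply: safe_seq.
  apply: (@safe_mono _ _ _ _ (fun s2 => [/\ ctx s2, imem s2 20 = (t != 0) :> nat &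
      freg s2 21 = l])).
    move=> s2 [cs2 f2 r2]; apply: safe_seq.
    have fr := safe_frame (w := false) (generator_cmdP cs2 f2) isT.
    apply: safe_mono fr => s3 [f3 [_ _ r3]] /=.
    have [l0 le] := quad_root charF sqE; rewrite -lE in l0 le.
    rewrite r2 in f3; rewrite f3 mE /genb l0; split=> // /andP[_ gl].
    by rewrite r3 // r2; split=> //; rewrite /genb l0.
  apply: safe_if => /= t0.
    split; first exact: bits_le_card.
    split=> //; by rewrite /= [t == 0]t0.
  split; first by apply: bits_le_card; apply: leq_trans (card_ge5 charF).
  split=> //; by rewrite /= t0.
(* For a maximally hyperbolic t the discriminant is (l - 1/l)^2, so the check of its square root
   would have succeeded. *)
have mE : max_hyp t = false.
  apply: contraNF sqd => /max_hyp_disc[x xd]; rewrite /sq dE -xd -expr2.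
  by rewrite (proj1 corE).
split; first exact: bits_le_card.
by rewrite mE.
Qed.

End Specs.

(** * The random walks *)

Section Walk.

Variables (F : finFieldType) (E : env F) (S n N : nat).
Hypothesis charF : forall p : nat, p \in [pchar F] -> (5 <= p)%N.
Hypothesis corE : correct_env E.
Hypotheses (LS : (bits #|F| < S)%N) (nS : (n < S)%N).

Local Notation safe := (safe E S).
Local Notation ctx := (@ctx F n N).

Variables (j l0 l1 : 'I_3) (src d code lam found : nat).
(** Both walks are treated at once. The numbers are concrete, so that disjointness of cells and
    registers is decided by computation. *)
Hypothesis conf : (src, d, code, lam, found) = (0, 6, 7, 12, 4)%N \/
                  (src, d, code, lam, found) = (3, 9, 8, 13, 5)%N.

Variable P0 : point F.
Implicit Types (s : state F).

Definition at_reg s (k : nat) : point F := (freg s k, freg s k.+1, freg s k.+2).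

Local Notation letter := (letter l0 l1).
Local Notation trial := (walk_trial j l0 l1 src d code lam found).

Lemma rot_cmdP i s :
  safe (rot_cmd i d) (fun s' => at_reg s' d = rot i (at_reg s d)) s.
Proof.
case: conf => [[_ -> _ _ _]|[_ -> _ _ _]];
by case: i => [[|[|[|i]]] lt] //; rewrite /rot_cmd /at_reg /= -?[1 + (1 + 1)]/(3 : F);
  congr (_, _, _); ring.
Qed.

(* The code of a walk is read from its last letter to the first. *)
Definition walked m s : Prop :=
  (imem s code < 2 ^ m)%N /\
  at_reg s d = apply_word P0 (map letter (rev (low_bits m (imem s code)))).

(** A step of the walk after its coin flip, isolated so that the two outcomes can be treated
    separately. *)
Definition turn : cmd :=
  prog [:: ISet (IConst code) (IAdd (IMul (IConst 2) (cell code)) (cell 10));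
    If (BILe (IConst 1) (cell 10)) (rot_cmd l1 d) (rot_cmd l0 d)].

Lemma turnP m (b : bool) s : (m < n)%N -> walked m s ->
  safe turn (fun s' => walked m.+1 s' /\ at_reg s' d = rot (letter b) (at_reg s d))
       (iset 10 b s).
Proof.
move=> mn [lt e].
have c10 : (code == 10)%N = false by case: conf => [[_ _ -> _ _]|[_ _ -> _ _]].
have c10' : (10 == code)%N = false by rewrite eq_sym.
have lt' := push_lt b lt.
have ev : ival (imem (iset 10 b s)) (IAdd (IMul (IConst 2) (cell code)) (cell 10))
    = (2 * imem s code + b)%N by rewrite /= c10.
apply: safe_ISet; rewrite ev.
  by apply: (@bits_small F S LS m.+1) => //; apply: leq_trans (ltnW nS).
set s1 := iset code _ _.
have fin i : i = letter b ->
    safe (rot_cmd i d) (safe Skip (fun s' => walked m.+1 s' /\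
      at_reg s' d = rot (letter b) (at_reg s d))) s1.
  move=> ->; apply: safe_mono (safe_frame (w := false) (rot_cmdP _ s1) isT).
  move=> s2 [e2 [_ m2 _]]; have e3 : at_reg s2 d = rot (letter b) (at_reg s d) by [].
  have c2 : imem s2 code = (2 * imem s code + b)%N by rewrite m2 //= eqxx.
  split; last exact: e3.
  rewrite /walked c2; split=> //.
  rewrite e3 low_bits_push rev_cons map_rcons e /apply_word foldl_rcons //.
apply: safe_seq; apply: safe_if; rewrite /= c10' => hb; apply: fin;
  by rewrite /letter; case: (b) hb.
Qed.

Definition wagree s s' := agree false (cells_of trial) (regs_of trial) s s'.

Lemma cells_trial :
  cells_of trial = [:: code; 10; code] ++ cells_of max_hyp_cmd ++ [:: found].
Proof. by []. Qed.

Lemma regs_trial : regs_of trial =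
  [:: d; d.+1; d.+2] ++ regs_of turn ++ 20%N :: regs_of max_hyp_cmd ++ [:: lam].
Proof. by []. Qed.

Lemma wagree_iset s v : wagree s (iset 10 v s).
Proof. by apply: agree_iset; rewrite cells_trial mem_cat !inE eqxx !orbT. Qed.

Lemma turn_wagree s Q : safe turn Q s -> safe turn (fun s' => Q s' /\ wagree s s') s.
Proof.
move=> H; apply: safe_mono (safe_frame (w := false) H isT) => s' [? ag]; split=> //.
apply: agree_sub ag => a ha.
  have : a \in [:: code] := ha; rewrite mem_seq1 => /eqP ->.
  by rewrite cells_trial mem_head.
by rewrite regs_trial mem_cat [in X in _ || X]mem_cat (ha : a \in regs_of turn) orbT.
Qed.

Lemma walk_loop_safe s Q : imem s 1 = n -> walked 0 s ->
    (forall s', walked n s' -> wagree s s' -> Q s') ->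
  safe (For (cell 1) (walk_step l0 l1 d code)) Q s.
Proof.
move=> c1 w0 HQ.
apply: (@safe_loop _ _ _ (fun k s' => walked (n - k) s' /\ wagree s s')).
- by rewrite [ival _ _]c1 ltnW.
- by rewrite [ival _ _]c1 subnn; split=> //; apply: agree_refl.
- rewrite [ival _ _]c1 => k s' kn [w ag].
  have kE : (n - k = (n - k.+1).+1)%N by lia.
  rewrite kE.
  have st (b : bool) : safe turn (fun s2 => walked (n - k.+1).+1 s2 /\ wagree s s2)
      (iset 10 b s').
    apply: safe_mono (turn_wagree (turnP b _ w)) => [s2 [[w2 _] ag2]|]; last by lia.
    split=> //; apply: agree_trans ag _.
    exact: agree_trans (wagree_iset s' b) ag2.
  by split; [apply: (st false)|apply: (st true)].
- by move=> s'; rewrite subn0 => -[w ag]; apply: HQ.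
Qed.

(** The indicator of [A] need only bound [f] from below; [f] will be the probability that [judge]
    accepts. *)
Lemma walk_loop_pr (A : pred (point F)) (f : state F -> rat) s : imem s 1 = n -> walked 0 s ->
    (forall s', walked n s' -> wagree s s' -> (A (at_reg s' d))%:R <= f s') ->
  (wcount l0 l1 A n (at_reg s d))%:R / 2 ^+ n
    <= pr E (For (cell 1) (walk_step l0 l1 d code)) f s.
Proof.
move=> c1 w0 Af; rewrite /= c1.
have gen k s' : (k <= n)%N -> walked (n - k) s' -> wagree s s' ->
    (wcount l0 l1 A k (at_reg s' d))%:R / 2 ^+ k
      <= iter k (pr E (walk_step l0 l1 d code)) f s'.
  elim: k s' => [|k IH] s' kn w ag.
    rewrite expr0 divr1; apply: Af => //; by rewrite subn0 in w.
  have st (b : bool) : (wcount l0 l1 A k (rot (letter b) (at_reg s' d)))%:R / 2 ^+ k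
      <= pr E turn (iter k (pr E (walk_step l0 l1 d code)) f) (iset 10 b s').
    apply: pr_ge (turn_wagree (turnP b _ w)) _; first by lia.
    move=> s2 [[w2 <-] ag2]; apply: IH; first exact: ltnW.
      by rewrite (_ : (n - k = (n - k.+1).+1)%N) //; lia.
    by apply: agree_trans ag _; apply: agree_trans (wagree_iset s' b) ag2.
  have -> : iter k.+1 (pr E (walk_step l0 l1 d code)) f s' =
      (pr E turn (iter k (pr E (walk_step l0 l1 d code)) f) (iset 10 false s') +
       pr E turn (iter k (pr E (walk_step l0 l1 d code)) f) (iset 10 true s')) / 2.
    by [].
  have := st false; have := st true; rewrite [wcount _ _ _ k.+1 _]/= natrD exprS invfM.
  by rewrite /letter; move: (2 ^- k) => y; nra.
apply: gen => //; first by rewrite subnn.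
exact: agree_refl.
Qed.

Definition judge : cmd :=
  prog [:: FSet 20 (FReg (d + j)); max_hyp_cmd; FSet lam (FReg 21);
    ISet (IConst found) (cell 20)].

Local Notation target s := (coord j (at_reg s d)).

Definition arrived s : Prop :=
  [/\ walked n s, max_hyp (target s) & eigen (freg s lam) (target s)].

Lemma judgeP s : ctx s -> walked n s ->
  safe judge (fun s' => imem s' found = max_hyp (target s) :> nat /\
    (max_hyp (target s) -> arrived s')) s.
Proof.
move=> cs w; apply: safe_FSet; apply: safe_seq.
have -> : fval (freg s) (FReg (d + j)) = target s.
  by case: (j) => [[|[|[|i]]] lt] //=; rewrite ?addn0 ?addn1 ?addn2.
set t := target s; set s1 := fset 20 t s.
have cs1 : ctx s1 by [].
have H := max_hyp_cmdP charF corE LS cs1.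
apply: safe_mono (safe_frame (w := false) H isT) => s2 [[f2 e2] [_ m2 r2]].
rewrite -[freg s1 20]/t in f2 e2.
apply: safe_FSet; rewrite /= f2; split.
  by apply: (bits_le_card LS); case: (max_hyp t); rewrite // (leq_trans _ (card_ge5 charF)).
rewrite eqxx; split=> // mt.
have at2 : at_reg (iset found (max_hyp t) (fset lam (freg s2 21) s2)) d = at_reg s d.
  by rewrite /at_reg; case: conf => [[_ -> _ -> _]|[_ -> _ -> _]] /=; rewrite !r2.
rewrite /arrived at2; split=> //; last by rewrite /= eqxx; apply: e2.
rewrite /walked at2 /=.
have -> : (code == found) = false by case: conf => [[_ _ -> _ ->]|[_ _ -> _ ->]].
by rewrite m2 //; case: conf => [[_ _ -> _ _]|[_ _ -> _ _]].
Qed.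

Definition start s : state F :=
  let s1 := fset d (freg s src) s in
  let s2 := fset d.+1 (freg s1 src.+1) s1 in
  iset code 0 (fset d.+2 (freg s2 src.+2) s2).

Lemma startP s : ctx s -> at_reg s src = P0 ->
  [/\ ctx (start s), walked 0 (start s) & at_reg (start s) d = P0].
Proof.
move=> cs sP.
have e : at_reg (start s) d = at_reg s src.
  by rewrite /at_reg /start; case: conf => [[-> -> _ _ _]|[-> -> _ _ _]].
have c0 : imem (start s) code = 0%N by rewrite /= eqxx.
split; [|by rewrite /walked c0 e sP|by rewrite e].
have ag : agree false [:: code] [:: d; d.+1; d.+2] s (start s).
  split=> [|a|x]; [by right|by rewrite mem_seq1 /= => /negbTE ->|].
  by rewrite !inE !negb_or /= => /and3P[/negbTE -> /negbTE -> /negbTE ->].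
by apply: (ctx_agree ag) cs; case: conf => [[_ _ -> _ _]|[_ _ -> _ _]].
Qed.

(** A trial preserves its own preconditions, so it can be repeated. *)
Lemma wagree_ctx s s' : ctx s -> wagree s s' -> ctx s' /\ at_reg s' src = at_reg s src.
Proof.
move=> cs ag; split.
  apply: (ctx_agree ag) cs; rewrite cells_trial.
  by case: conf => [[_ _ -> _ ->]|[_ _ -> _ ->]].
case: ag => _ _ r.
suff nin k : (k < 3)%N -> (src + k)%N \notin regs_of trial.
  have := nin 0%N isT; have := nin 1%N isT; have := nin 2%N isT.
  rewrite addn0 addn1 addn2 => n2 n1 n0.
  by rewrite /at_reg (r src) // (r src.+1) // (r src.+2).
move=> k3; have [s0 d6 ld] : [/\ (src + 3 <= d)%N, (d <= 9)%N & (d + 3 <= lam)%N].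
  by case: conf => [[-> -> _ -> _]|[-> -> _ -> _]].
have reg3 i x : x \in regs_of (rot_cmd i d) -> (d <= x)%N.
  rewrite /= !inE => /or3P[] /eqP ->; rewrite ?leq_addr //; lia.
rewrite regs_trial mem_cat negb_or mem_cat negb_or; apply/and3P; split.
- by rewrite !inE; lia.
- have -> : regs_of turn = (regs_of (rot_cmd l1 d) ++ regs_of (rot_cmd l0 d)) ++ [::] by [].
  rewrite cats0 mem_cat; apply/negP => /orP[] /reg3; lia.
- rewrite /= !inE; lia.
Qed.

Lemma trial_safe s : ctx s -> at_reg s src = P0 ->
  safe trial (fun s' => wagree s s' /\ ((0 < imem s' found)%N -> arrived s')) s.
Proof.
move=> cs sP; have [cs0 w0 _] := startP cs sP.
have H : safe trial (fun s' => (0 < imem s' found)%N -> arrived s') s.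
  do 3!apply: safe_FSet; apply: safe_ISet; first exact: (bits_le_card LS).
  have [_ c1 _ _ _] := cs0.
  suff : safe (For (cell 1) (walk_step l0 l1 d code))
    (safe judge (fun s' => (0 < imem s' found)%N -> arrived s')) (start s) by [].
  apply: (walk_loop_safe c1 w0) => s' w' ag.
  have cs' : ctx s'.
    apply: (ctx_agree ag) cs0; rewrite cells_trial.
    by case: conf => [[_ _ -> _ ->]|[_ _ -> _ ->]].
  apply: safe_mono (judgeP cs' w') => s2 [-> H].
  by case: (max_hyp _) H => // H _; apply: H.
by apply: safe_mono (safe_frame (w := false) H isT) => s' [].
Qed.

Hypothesis lettersE : forall i, (i != j) = (i == l0) || (i == l1).
Hypothesis letters_neq : l0 != l1.

Lemma trial_pr s : ctx s -> at_reg s src = P0 ->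
  walk_prob n j P0 <= pr E trial (fun s' => (0 < imem s' found)%N%:R) s.
Proof.
move=> cs sP; have [cs0 w0 aP] := startP cs sP; have [_ c1 _ _ _] := cs0.
pose h s' : rat := pr E judge (fun s2 => (0 < imem s2 found)%N%:R) s'.
rewrite (walk_probE lettersE letters_neq) -aP.
have -> : pr E trial (fun s' => (0 < imem s' found)%N%:R) s =
    pr E (For (cell 1) (walk_step l0 l1 d code)) h (start s) by [].
apply: walk_loop_pr => // s' w' ag.
have cs' : ctx s'.
  apply: (ctx_agree ag) cs0; rewrite cells_trial.
  by case: conf => [[_ _ -> _ ->]|[_ _ -> _ ->]].
by apply: pr_ge (judgeP cs' w') _ => s2 [-> _]; case: (max_hyp _).
Qed.

Hypothesis NS : (N <= S)%N.

Lemma walk_search_safe s : ctx s -> at_reg s src = P0 -> imem s found = 0%N ->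
  safe (search (cell 3) found trial)
    (fun s' => wagree s s' /\ ((0 < imem s' found)%N -> arrived s')) s.
Proof.
move=> cs sP f0; apply: safe_search.
- by split; [apply: agree_refl|rewrite f0].
- by have [_ _ _ c3 _] := cs; rewrite [ival _ _]c3.
move=> s' [ag _] _; have [cs' sP'] := wagree_ctx cs ag; rewrite sP in sP'.
apply: safe_mono (trial_safe cs' sP') => s2 [ag2 H2]; split=> //.
exact: agree_trans ag ag2.
Qed.

Lemma walk_search_pr (f : state F -> rat) (p x : rat) s :
    ctx s -> at_reg s src = P0 -> imem s found = 0%N ->
    0 <= p <= walk_prob n j P0 -> p <= 1 -> 0 <= x -> (forall s', 0 <= f s') ->
    (forall s', wagree s s' -> (0 < imem s' found)%N -> arrived s' -> x <= f s') ->
  (1 - (1 - p) ^+ N) * x <= pr E (search (cell 3) found trial) f s.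
Proof.
move=> cs sP f0 /andP[p0 pw] p1 x0 fx0 fx; have [_ _ _ c3 _] := cs.
have {1}-> : N = ival (imem s) (cell 3) by [].
apply: (@pr_search _ _ S (fun s' => wagree s s' /\ ((0 < imem s' found)%N -> arrived s'))) => //.
- by split; [apply: agree_refl|rewrite f0].
- move=> s' [ag _] _; have [cs' sP'] := wagree_ctx cs ag; rewrite sP in sP'.
  apply: safe_mono (trial_safe cs' sP') => s2 [ag2 H2]; split=> //.
  exact: agree_trans ag ag2.
- move=> s' [ag _] _; have [cs' sP'] := wagree_ctx cs ag; rewrite sP in sP'.
  exact: le_trans pw (trial_pr cs' sP').
- by rewrite p0.
- by move=> s' [ag H] fs; apply: fx => //; apply: H.
Qed.

End Walk.

(** * The search on the curve *)

Section Curve.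

Variables (F : finFieldType) (E : env F) (S n N : nat).
Hypothesis charF : forall p : nat, p \in [pchar F] -> (5 <= p)%N.
Hypothesis corE : correct_env E.
Hypotheses (LS : (bits #|F| < S)%N) (NS : (N <= S)%N).

Local Notation safe := (safe E S).
Local Notation ctx := (@ctx F n N).
Implicit Types (s : state F) (a b t : F).

Definition cdisc a t : F := (3 * t * a) ^+ 2 - 4 * (t ^+ 2 + a ^+ 2).

Lemma conic_discE (r : nat -> F) e1 e2 :
  fval r (conic_disc e1 e2) = cdisc (fval r e1) (fval r e2).
Proof. by rewrite /cdisc -(fval4 r) /= !expr2. Qed.

Lemma conic_rootP a t x : x ^+ 2 = cdisc a t -> markoffF t a ((3 * t * a + x) / 2) = 0.
Proof.
move=> e; have n2 := neq0_2 charF; have n4 := neq0_4 charF.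
have -> : markoffF t a ((3 * t * a + x) / 2) = (x ^+ 2 - cdisc a t) / 4.
  by rewrite /markoffF /cdisc; field; rewrite n2 n4.
by rewrite e subrr mul0r.
Qed.

Lemma markoffC (x y z : F) : markoffF x y z = markoffF x z y.
Proof. by rewrite /markoffF; ring. Qed.

Definition has_root a t : bool := [exists z, markoffF t a z == 0].

(** 4 F(t, a, z) is (2z - 3ta)^2 minus the discriminant, so a zero exists exactly when the
    discriminant is a square, which is what the machine checks. *)
Lemma has_rootP a t : has_root a t = (sqrt_of E (cdisc a t) ^+ 2 == cdisc a t).
Proof.
apply/existsP/eqP => [[z /eqP z0]|e]; last by eexists; apply/eqP/(conic_rootP e).
have -> : cdisc a t = (2 * z - 3 * t * a) ^+ 2.
  transitivity ((2 * z - 3 * t * a) ^+ 2 - 4 * markoffF t a z); last first.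
    by rewrite z0 mulr0 subr0.
  by rewrite /cdisc /markoffF; ring.
exact: (proj1 corE).
Qed.

Definition on_link s : Prop :=
  [/\ max_hyp (freg s 15), eigen (freg s 14) (freg s 15),
      markoffF (freg s 15) (freg s 7) (freg s 16) = 0
    & markoffF (freg s 15) (freg s 17) (freg s 11) = 0].

(** The trial for a value of t that is already drawn. *)
Definition curve_test : cmd := if curve_trial is Seq _ c then c else Skip.

Lemma curve_testP s : ctx s -> imem s 6 = 0%N ->
  let t := freg s 15 in
  safe curve_test (fun s' =>
    (0 < imem s' 6)%N = [&& max_hyp t, has_root (freg s 7) t & has_root (freg s 11) t] /\
    ((0 < imem s' 6)%N -> on_link s')) s.
Proof.
move=> cs f0 t; apply: safe_FSet; apply: safe_seq.
set s1 := fset 20 _ s; have cs1 : ctx s1 by [].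
have H := max_hyp_cmdP charF corE LS cs1.
apply: safe_mono (safe_frame (w := false) H isT) => s2 [[f2 e2] [_ m2 r2]].
rewrite -[freg s1 20]/t in f2 e2.
have r15 : freg s2 15 = t by rewrite r2.
have r7 : freg s2 7 = freg s 7 by rewrite r2.
have r11 : freg s2 11 = freg s 11 by rewrite r2.
have m6 : imem s2 6 = 0%N by rewrite m2.
apply: safe_FSet; do 2!apply: safe_FSqrt; do 2!apply: safe_FSet.
set s6 := fset 17 _ _.
pose q1 := sqrt_of E (cdisc (freg s 7) t); pose q2 := sqrt_of E (cdisc (freg s 11) t).
have h18 : freg s6 18 = q1.
  transitivity (sqrt_of E (fval (freg (fset 14 (freg s2 21) s2))
    (conic_disc (FReg 7) (FReg 15)))); first by [].
  by rewrite conic_discE /= r7 r15.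
have h19 : freg s6 19 = q2.
  transitivity (sqrt_of E (fval (freg (fset 18 (freg s6 18) (fset 14 (freg s2 21) s2)))
    (conic_disc (FReg 11) (FReg 15)))); first by [].
  by rewrite conic_discE /= r11 r15.
have h16 : freg s6 16 = (3 * t * freg s 7 + q1) / 2.
  transitivity ((3 * freg s2 15 * freg s2 7 + freg s6 18) / 2); first by [].
  by rewrite r15 r7 h18.
have h17 : freg s6 17 = (3 * t * freg s 11 + q2) / 2.
  transitivity ((3 * freg s2 15 * freg s2 11 + freg s6 19) / 2); first by [].
  by rewrite r15 r11 h19.
have h15 : freg s6 15 = t by [].
have h14 : freg s6 14 = freg s2 21 by [].
have h7 : freg s6 7 = freg s 7 by [].
have h11 : freg s6 11 = freg s 11 by [].
have k20 : imem s6 20 = max_hyp t :> nat by [].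
have k6 : imem s6 6 = 0%N by [].
move: s6 h18 h19 h16 h17 h15 h14 h7 h11 k20 k6 => s6 h18 h19 h16 h17 h15 h14 h7 h11 k20 k6.
apply: safe_seq; apply: safe_if; rewrite /bval conic_discE [fval _ (FSq _)]/=
  [fval _ (FReg 7)]/= [fval _ (FReg 15)]/= h18 h7 h15 -expr2 -has_rootP; last first.
  by move=> /negbTE ->; rewrite /= k6 andbF.
move=> d1; apply: safe_if; rewrite /bval conic_discE [fval _ (FSq _)]/=
  [fval _ (FReg 11)]/= [fval _ (FReg 15)]/= h19 h11 h15 -expr2 -has_rootP; last first.
  by move=> /negbTE ->; rewrite /= k6 !andbF.
move=> d2; rewrite d1 d2 !andbT /= k20; split.
  by apply: (bits_le_card LS); case: (max_hyp t); rewrite // (leq_trans _ (card_ge5 charF)).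
split; first by case: (max_hyp t).
case mt : (max_hyp t) => // _; split; rewrite /= ?h15 //.
- by rewrite h14; apply: e2.
- by rewrite h7 h16; apply: conic_rootP; apply/eqP; rewrite -has_rootP.
- by rewrite h11 h17 markoffC; apply: conic_rootP; apply/eqP; rewrite -has_rootP.
Qed.

Definition cagree s s' := agree false (cells_of curve_trial) (regs_of curve_trial) s s'.

Lemma cagree_ctx s s' : ctx s -> cagree s s' -> ctx s'.
Proof. by move=> cs ag; apply: (ctx_agree ag) cs. Qed.

Lemma curve_trial_safe s : ctx s -> imem s 6 = 0%N ->
  safe curve_trial (fun s' => cagree s s' /\ ((0 < imem s' 6)%N -> on_link s')) s.
Proof.
move=> cs f0.
have H : safe curve_trial (fun s' => (0 < imem s' 6)%N -> on_link s') s.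
  by move=> t; apply: safe_mono (curve_testP (s := fset 15 t s) cs f0) => s' [].
by apply: safe_mono (safe_frame (w := false) H isT) => s' [].
Qed.

(** Heuristic B draws a nonzero t, the machine any t in F_q: hence the factor (q - 1) / q. The value
    t = 0 is never maximally hyperbolic. *)
Lemma curve_trial_pr s : ctx s -> imem s 6 = 0%N ->
  curve_prob (freg s 7) (freg s 11) * (#|F|.-1%:R / #|F|%:R) <=
    pr E curve_trial (fun s' => (0 < imem s' 6)%N%:R) s.
Proof.
move=> cs f0; set a := freg s 7; set b := freg s 11.
pose ok t := [&& max_hyp t, has_root a t & has_root b t].
have -> : pr E curve_trial (fun s' => (0 < imem s' 6)%N%:R) s =
  (\sum_(t : F) pr E curve_test (fun s' => (0 < imem s' 6)%N%:R) (fset 15 t s)) / #|F|%:R by [].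
have q0 : 0 < #|F|.-1%:R :> rat by rewrite ltr0n card_pred_gt0.
have -> : curve_prob a b = #|[set t | ok t]|%:R / #|F|.-1%:R.
  rewrite /curve_prob; congr (_%:R / _%:R); last first.
    by rewrite -(cardsC1 (0 : F)); apply: eq_card => t; rewrite !inE.
  apply: eq_card => t; rewrite !inE /ok /has_root.
  have [->|t0] /= := eqVneq t 0; first by rewrite /max_hyp eqxx.
  (* For fixed t, the two equations of the curve involve z and y separately. *)
  congr (_ && _); apply/existsP/andP.
  + case=> y /existsP[z /andP[h1 h2]].
    by split; apply/existsP; [exists z|exists y; rewrite markoffC].
  + case=> /existsP[z h1] /existsP[y h2].
    by exists y; apply/existsP; exists z; rewrite /on_curve h1 markoffC.
rewrite mulrA divfK ?gt_eqF // ler_wpM2r ?invr_ge0 ?ler0n //.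
rewrite -sum1_card natr_sum big_mkcond; apply: ler_sum => t _.
have T : safe curve_test (fun s' => (0 < imem s' 6)%N = ok t /\
    ((0 < imem s' 6)%N -> on_link s')) (fset 15 t s).
  exact: (curve_testP (s := fset 15 t s)).
apply: (pr_ge T) => s' [-> _].
by rewrite inE; case: (ok t).
Qed.

Lemma curve_search_safe s : ctx s -> imem s 6 = 0%N ->
  safe (search (cell 3) 6 curve_trial)
    (fun s' => cagree s s' /\ ((0 < imem s' 6)%N -> on_link s')) s.
Proof.
move=> cs f0; apply: safe_search.
- by split; [apply: agree_refl|rewrite f0].
- by have [_ _ _ c3 _] := cs; rewrite [ival _ _]c3.
move=> s' [ag _] f0'; have cs' := cagree_ctx cs ag.
apply: safe_mono (curve_trial_safe cs' f0') => s2 [ag2 H2]; split=> //.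
exact: agree_trans ag ag2.
Qed.

Lemma curve_search_pr (f : state F -> rat) (p x : rat) s :
    ctx s -> imem s 6 = 0%N ->
    0 <= p <= curve_prob (freg s 7) (freg s 11) * (#|F|.-1%:R / #|F|%:R) ->
    p <= 1 -> 0 <= x -> (forall s', 0 <= f s') ->
    (forall s', cagree s s' -> (0 < imem s' 6)%N -> on_link s' -> x <= f s') ->
  (1 - (1 - p) ^+ N) * x <= pr E (search (cell 3) 6 curve_trial) f s.
Proof.
move=> cs f0 /andP[p0 pw] p1 x0 fx0 fx; have [_ _ _ c3 _] := cs.
have {1}-> : N = ival (imem s) (cell 3) by [].
apply: (@pr_search _ _ S (fun s' => cagree s s' /\ ((0 < imem s' 6)%N -> on_link s'))) => //.
- by split; [apply: agree_refl|rewrite f0].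
- move=> s' [ag _] f0'; have cs' := cagree_ctx cs ag.
  apply: safe_mono (curve_trial_safe cs' f0') => s2 [ag2 H2]; split=> //.
  exact: agree_trans ag ag2.
- move=> s' [ag _] f0'; have cs' := cagree_ctx cs ag.
  apply: le_trans pw _; have := curve_trial_pr cs' f0'.
  by case: ag => _ _ r; rewrite !r.
- by rewrite p0.
- by move=> s' [ag H] fs; apply: fx => //; apply: H.
Qed.

End Curve.

(** * Writing the path *)

(** The lowest digit is read first, so letters come out last first: the order needed to undo the
    walk from Q. The code of the walk from P is therefore reversed by [reverse_cmd] beforehand. *)
Definition emit_cmd (code : nat) (l0 l1 : 'I_3) (e : iexp) : cmd :=
  For (cell 1) (prog [::
    If (BILe (IConst 1) (IMod (cell code) (IConst 2))) (Emit l1 e) (Emit l0 e);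
    ISet (IConst code) (IDiv (cell code) (IConst 2))]).

Definition reverse_cmd : cmd :=
  prog [:: ISet (IConst 9) (IConst 0);
    For (cell 1) (prog [::
      ISet (IConst 9) (IAdd (IMul (IConst 2) (cell 9)) (IMod (cell 7) (IConst 2)));
      ISet (IConst 7) (IDiv (cell 7) (IConst 2))])].

Definition form_exp (lam u v : fexp) : fexp := FSub u (FMul (FInv lam) v).

Definition dlog_cmd (c : nat) (i : 'I_3) (lam u v u' v' : fexp) : cmd :=
  prog [:: DLog (IConst c) lam (FDiv (form_exp lam u' v') (form_exp lam u v));
    Emit i (cell c)].

(* One less than the order of GL_2(F_q), so that rho_i to this power is the
   inverse of rho_i. *)
Definition inverse_exp : iexp :=
  ISub (IMul (IMul (cell 0) (IMul (ISub (cell 0) (IConst 1)) (ISub (cell 0) (IConst 1))))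
    (IAdd (cell 0) (IConst 1))) (IConst 1).

Definition i0 : 'I_3 := @Ordinal 3 0 isT.
Definition i1 : 'I_3 := @Ordinal 3 1 isT.
Definition i2 : 'I_3 := @Ordinal 3 2 isT.

(** With a, b, t in registers 7, 11, 15, the three logarithms lead from the end of the walk from P
    to (t, a, z), on to (t, y, b), and on to the end of the walk from Q; they fix in turn y = a, x =
    t and z = b. *)
Definition finish_cmd : cmd :=
  prog [:: reverse_cmd; emit_cmd 9 i0 i2 (IConst 1);
    dlog_cmd 11 i1 (FReg 12) (FReg 6) (FReg 8) (FReg 15) (FReg 16);
    dlog_cmd 12 i0 (FReg 14) (FReg 16) (FReg 7) (FReg 11) (FReg 17);
    dlog_cmd 13 i2 (FReg 13) (FReg 17) (FReg 15) (FReg 10) (FReg 9);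
    emit_cmd 8 i0 i1 inverse_exp].

Definition when (a : nat) (c : cmd) : cmd := If (BILe (IConst 1) (cell a)) c Skip.

Section Finish.

Variables (F : finFieldType) (E : env F) (S n N : nat).
Hypothesis charF : forall p : nat, p \in [pchar F] -> (5 <= p)%N.
Hypothesis corE : correct_env E.
Hypotheses (LS : (bits #|F| < S)%N) (nS : (n < S)%N).

Local Notation safe := (safe E S).
Local Notation ctx := (@ctx F n N).
Implicit Types (s : state F) (a t : F).

Lemma emit_cmdP code l0 l1 e (v : nat) s : (3 < code)%N -> imem s 1 = n ->
    (imem s code < 2 ^ n)%N ->
    (forall s', imem s' 0 = imem s 0 -> ival (imem s') e = v) ->
  safe (emit_cmd code l0 l1 e) (fun s' => output s' = output s ++
    [seq (letter l0 l1 b, v) | b <- low_bits n (imem s code)]) s.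
Proof.
move=> c3 c1 lt ev.
pose I k s' := [/\ imem s' 0 = imem s 0, (imem s' code < 2 ^ k)%N &
  output s' ++ [seq (letter l0 l1 b, v) | b <- low_bits k (imem s' code)] =
  output s ++ [seq (letter l0 l1 b, v) | b <- low_bits n (imem s code)]].
have c0 : (0 == code)%N = false by lia.
apply: (@safe_loop _ _ _ I).
- by rewrite [ival _ _]c1 ltnW.
- by rewrite [ival _ _]c1.
- rewrite [ival _ _]c1 => k s' kn [e0 lt' o].
  have lt2 : (imem s' code %/ 2 < 2 ^ k)%N by rewrite ltn_divLR // mulnC -expnS.
  have bd : (bits (imem s' code %/ 2) <= S)%N.
    by apply: (bits_small LS _ lt2); apply: ltnW; apply: ltn_trans nS.
  have ev' := ev s' e0.
  rewrite /I /= ev' modn2 lt0b -o /= => {o}.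
  by case: (odd (imem s' code)); rewrite /= eqxx c0; split=> //; split; rewrite ?cat_rcons.
- by move=> s' [_ _]; rewrite cats0.
Qed.

Lemma reverse_cmdP s : imem s 1 = n -> (imem s 7 < 2 ^ n)%N ->
  safe reverse_cmd (fun s' => (imem s' 9 < 2 ^ n)%N /\
    low_bits n (imem s' 9) = rev (low_bits n (imem s 7))) s.
Proof.
move=> c1 lt.
pose I k s' := [/\ (imem s' 7 < 2 ^ k)%N, (imem s' 9 < 2 ^ (n - k))%N &
  rev (low_bits k (imem s' 7)) ++ low_bits (n - k) (imem s' 9) =
  rev (low_bits n (imem s 7))].
apply: safe_ISet; first exact: (bits_le_card LS).
apply: safe_seq; apply: (@safe_loop _ _ _ I).
- by rewrite [ival _ _]c1 ltnW.
- by rewrite [ival _ _]c1 /I subnn /= cats0.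
- rewrite [ival _ _]c1 => k s' kn [lt7 lt9 o].
  have lt2 : (imem s' 7 %/ 2 < 2 ^ k)%N by rewrite ltn_divLR // mulnC -expnS.
  have kE : (n - k = (n - k.+1).+1)%N by lia.
  have lt9' := push_lt (odd (imem s' 7)) lt9; rewrite -kE in lt9'.
  rewrite /I /= modn2; split; first by apply: (bits_small LS _ lt9'); lia.
  split; first by apply: (bits_small LS _ lt2); lia.
  split=> //=; rewrite kE low_bits_push -o /= rev_cons -cats1 -catA //.
- by move=> s' [_ ]; rewrite subn0 /= => h1 h2; split.
Qed.

Lemma dlog_ofP l h : genb l -> h != 0 ->
  (dlog_of E l h < #|F|.-1)%N /\ l ^+ dlog_of E l h = h.
Proof.
move=> gl h0; have /andP[l0 _] := gl.
have Ul : l \is a GRing.unit by rewrite unitfE.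
have Uh : h \is a GRing.unit by rewrite unitfE.
have gU : generator [set: {unit F}] (FinRing.unit F Ul) by rewrite genb_unit.
have [lt e] := proj2 corE _ (FinRing.unit F Uh) gU; split=> //.
by rewrite -[X in X ^+ _]/(FinRing.uval (FinRing.unit F Ul)) -val_unitX e.
Qed.

Lemma dlog_cmdP c i lam u v u' v' a s :
    let r := freg s in
    eigen (fval r lam) a -> a != 0 ->
    Mstar (pt i a (fval r u) (fval r v)) -> Mstar (pt i a (fval r u') (fval r v')) ->
  safe (dlog_cmd c i lam u v u' v') (fun s' => exists e,
    output s' = rcons (output s) (i, e) /\
    iter e (rot i) (pt i a (fval r u) (fval r v)) = pt i a (fval r u') (fval r v')) s.
Proof.
move=> r [gl la] a0 M M'; have /andP[l0 _] := gl.
have f0 := form_neq0 l0 la a0 M; have f0' := form_neq0 l0 la a0 M'.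
have h0 : fval r (FDiv (form_exp lam u' v') (form_exp lam u v)) != 0.
  by rewrite /= mulf_neq0 // invr_eq0.
have [lt e] := dlog_ofP gl h0.
split; first exact: (bits_le_card LS (leq_trans (ltnW lt) (leq_pred _))).
exists (dlog_of E (fval r lam) (fval r (FDiv (form_exp lam u' v') (form_exp lam u v)))).
split; first by rewrite /= eqxx.
by apply: (link charF gl la) => //; rewrite e /= divfK.
Qed.

Lemma dlog_cmd_link c i lam u v u' v' (l a x y x' y' : F) (A B : point F) s :
    fval (freg s) lam = l -> fval (freg s) u = x -> fval (freg s) v = y ->
    fval (freg s) u' = x' -> fval (freg s) v' = y' ->
    A = pt i a x y -> B = pt i a x' y' ->
    eigen l a -> a != 0 -> Mstar A -> Mstar B ->
  safe (dlog_cmd c i lam u v u' v') (fun s' => exists e,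
    output s' = rcons (output s) (i, e) /\ iter e (rot i) A = B) s.
Proof. by move=> <- <- <- <- <- -> ->; apply: dlog_cmdP. Qed.

Lemma unwind l0 l1 (v : nat) (P : point F) bs : v = (#|F| * #|F|.-1 ^ 2 * #|F|.+1).-1 ->
  apply_word (apply_word P (map (letter l0 l1) bs))
    (expand [seq (letter l0 l1 b, v) | b <- rev bs]) = P.
Proof.
move=> ->; elim/last_ind: bs P => [//|bs b IH] P.
rewrite map_rcons rev_rcons /= -[expand (_ :: _)]/(nseq _ _ ++ expand _).
rewrite apply_word_cat apply_word_nseq {2}/apply_word foldl_rcons rotK //.
exact: IH.
Qed.

Lemma expand_ones l0 l1 bs :
  expand [seq (letter l0 l1 b, 1%N) | b <- bs] = map (letter l0 l1) bs.
Proof. by elim: bs => //= b bs <-. Qed.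

Lemma Mstar_markoff (x y z : F) : x != 0 -> markoffF x y z = 0 -> Mstar (x, y, z).
Proof.
move=> x0 e; rewrite /Mstar !xpair_eqE (negbTE x0) /=.
by rewrite -subr_eq0; apply/eqP.
Qed.

Variables P Q : point F.
Hypotheses (MP : Mstar P) (MQ : Mstar Q).

Definition arrivedP := arrived n i1 i0 i2 6 7 12 P.
Definition arrivedQ := arrived n i2 i0 i1 9 8 13 Q.

Lemma finish_cmdP s : ctx s -> output s = [::] ->
    arrivedP s -> arrivedQ s -> on_link s ->
  safe finish_cmd (fun s' => is_path P Q (output s')) s.
Proof.
move=> cs o0 [[lt7 aP] hypP eigP] [[lt8 aQ] hypQ eigQ] [hypt eigt mk1 mk2].
have [c0 c1 _ _ _] := cs.
have at6 : at_reg s 6 = pt i1 (freg s 7) (freg s 6) (freg s 8).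
  by [].
have at9 : at_reg s 9 = pt i2 (freg s 11) (freg s 10) (freg s 9).
  by [].
(* Each connecting point lies on two conics and is written once for each. *)
have pt1 : (freg s 15, freg s 7, freg s 16) = pt i1 (freg s 7) (freg s 15) (freg s 16).
  by [].
have pt1' : (freg s 15, freg s 7, freg s 16) = pt i0 (freg s 15) (freg s 16) (freg s 7).
  by [].
have pt2 : (freg s 15, freg s 17, freg s 11) = pt i0 (freg s 15) (freg s 11) (freg s 17).
  by [].
have pt2' : (freg s 15, freg s 17, freg s 11) = pt i2 (freg s 11) (freg s 17) (freg s 15).
  by [].
have cP : coord i1 (at_reg s 6) = freg s 7 by [].
have cQ : coord i2 (at_reg s 9) = freg s 11 by [].
rewrite cP in hypP eigP; rewrite cQ in hypQ eigQ.
have [t0 _] := max_hyp_ex hypt; have [a0 _] := max_hyp_ex hypP.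
have [b0 _] := max_hyp_ex hypQ.
have M1 := Mstar_markoff t0 mk1; have M2 := Mstar_markoff t0 mk2.
have M6 : Mstar (at_reg s 6) by rewrite aP; apply: Mstar_word.
have M9 : Mstar (at_reg s 9) by rewrite aQ; apply: Mstar_word.
apply: safe_seq.
apply: safe_mono (safe_frame (w := false) (reverse_cmdP c1 lt7) isT) => s1.
move=> [[lt9 rv] [o1 m1 r1]]; case: o1 => // o1.
apply: safe_seq.
have H1 := @emit_cmdP 9 i0 i2 (IConst 1) 1 s1 isT (etrans (m1 1%N isT) c1) lt9 (fun _ _ => erefl).
apply: safe_mono (safe_frame (w := true) H1 isT) => s2 [o2 [_ m2 r2]].
have R2 x : freg s2 x = freg s x by rewrite r2 // r1.
apply: safe_seq.
have H2 := @dlog_cmd_link 11 i1 (FReg 12) (FReg 6) (FReg 8) (FReg 15) (FReg 16) _ _ _ _ _ _ _ _ _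
  (R2 12%N) (R2 6%N) (R2 8%N) (R2 15%N) (R2 16%N) at6 pt1 eigP a0 M6 M1.
apply: safe_mono (safe_frame (w := true) H2 isT).
move=> s3 [[e1 [o3 p1]] [_ m3 r3]].
have R3 x : freg s3 x = freg s x by rewrite r3 // R2.
apply: safe_seq.
have H3 := @dlog_cmd_link 12 i0 (FReg 14) (FReg 16) (FReg 7) (FReg 11) (FReg 17) _ _ _ _ _ _ _ _ _
  (R3 14%N) (R3 16%N) (R3 7%N) (R3 11%N) (R3 17%N) pt1' pt2 eigt t0 M1 M2.
apply: safe_mono (safe_frame (w := true) H3 isT).
move=> s4 [[e2 [o4 p2]] [_ m4 r4]].
have R4 x : freg s4 x = freg s x by rewrite r4 // R3.
apply: safe_seq.
have H4 := @dlog_cmd_link 13 i2 (FReg 13) (FReg 17) (FReg 15) (FReg 10) (FReg 9) _ _ _ _ _ _ _ _ _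
  (R4 13%N) (R4 17%N) (R4 15%N) (R4 10%N) (R4 9%N) pt2' at9 eigQ b0 M2 M9.
apply: safe_mono (safe_frame (w := true) H4 isT).
move=> s5 [[e3 [o5 p3]] [_ m5 r5]].
apply: safe_seq.
have M x : x \notin [:: 7; 9; 11; 12; 13]%N -> imem s5 x = imem s x.
  rewrite !inE !negb_or => /and5P[x7 x9 x11 x12 x13].
  rewrite m5 ?inE //= m4 ?inE //= m3 ?inE //= m2 ?inE //= m1 //= !inE !negb_or x9 x7 //.
pose v := (#|F| * #|F|.-1 ^ 2 * #|F|.+1).-1.
have ev s' : imem s' 0 = imem s5 0 -> ival (imem s') inverse_exp = v.
  by rewrite /= => ->; rewrite (M 0%N) // c0 !subn1 addn1 /v -mulnn.
have M1c : imem s5 1 = n by rewrite M.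
have M8c : imem s5 8 = imem s 8 by rewrite M.
have lt8' : (imem s5 8 < 2 ^ n)%N by rewrite M8c.
apply: safe_mono (@emit_cmdP 8 i0 i1 inverse_exp v s5 isT M1c lt8' ev) => s6.
rewrite M8c o5 o4 o3 o2 o1 o0 cat0s /= => o6.
have -> : output s6 = [seq (letter i0 i2 b, 1%N) | b <- low_bits n (imem s1 9)] ++
    [:: (i1, e1); (i0, e2); (i2, e3)] ++
    [seq (letter i0 i1 b, v) | b <- low_bits n (imem s 8)].
  by rewrite o6 -!cats1 -!catA.
apply: is_path_word => //.
rewrite !expand_cat !apply_word_cat expand_ones rv -aP.
rewrite /= !apply_word_nseq p1 p2 p3 aQ.
(* The walk from Q is the reversed list of digits of its code, while the emission follows the list
   itself. *)
by have := unwind i0 i1 Q (rev (low_bits n (imem s 8))) (erefl v); rewrite revK.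
Qed.

End Finish.

(** * The path finder *)

Definition walkP := walk_trial i1 i0 i2 0 6 7 12 4.
Definition walkQ := walk_trial i2 i0 i1 3 9 8 13 5.

Definition finale : cmd := when 4 (when 5 (when 6 finish_cmd)).

Definition main_cmd : cmd :=
  Seq (search (cell 3) 4 walkP)
    (Seq (search (cell 3) 5 walkQ) (Seq (search (cell 3) 6 curve_trial) finale)).

Fixpoint ipow (e : iexp) (k : nat) : iexp :=
  if k is k'.+1 then IMul e (ipow e k') else IConst 1.

(* n0 q <= c * bits q ^ k, and each trial succeeds with probability at least
   1 / (32 M bits q), where M is an upper bound on K. *)
Definition prologue (c k M : nat) : cmd :=
  prog [:: ISet (IConst 1) (IMul (IConst c) (ipow (IBits (cell 0)) k));
    ISet (IConst 2) (IBits (cell 0));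
    ISet (IConst 3) (IMul (IMul (IConst (32 * M)) (cell 2)) (IAdd (cell 2) (IConst 2)));
    Factor (IConst 100) (ISub (cell 0) (IConst 1))].

Definition pathfinder (c k M : nat) : cmd := Seq (prologue c k M) main_cmd.

Section Main.

Variables (F : finFieldType) (E : env F) (S n N : nat).
Hypothesis charF : forall p : nat, p \in [pchar F] -> (5 <= p)%N.
Hypothesis corE : correct_env E.
Hypotheses (LS : (bits #|F| < S)%N) (nS : (n < S)%N) (NS : (N <= S)%N).
Variables P Q : point F.
Hypotheses (MP : Mstar P) (MQ : Mstar Q).

Local Notation safe := (safe E S).
Local Notation ctx := (@ctx F n N).
Local Notation arrivedP := (arrivedP n P).
Local Notation arrivedQ := (arrivedQ n Q).
Implicit Types (s : state F).

Lemma arrived_eq j l0 l1 d code lam (P0 : point F) s s' :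
    imem s' code = imem s code -> at_reg s' d = at_reg s d -> freg s' lam = freg s lam ->
  arrived n j l0 l1 d code lam P0 s -> arrived n j l0 l1 d code lam P0 s'.
Proof. by rewrite /arrived /walked => -> -> ->. Qed.

Definition ready s : Prop :=
  [/\ ctx s, output s = [::], at_reg s 0 = P, at_reg s 3 = Q &
      [/\ imem s 4 = 0%N, imem s 5 = 0%N & imem s 6 = 0%N]].

Definition stage1 s : Prop :=
  [/\ ctx s, output s = [::], at_reg s 3 = Q, (0 < imem s 4)%N -> arrivedP s &
      imem s 5 = 0%N /\ imem s 6 = 0%N].

Definition stage2 s : Prop :=
  [/\ ctx s, output s = [::], (0 < imem s 4)%N -> arrivedP s,
      (0 < imem s 5)%N -> arrivedQ s & imem s 6 = 0%N].

Definition stage3 s : Prop :=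
  [/\ ctx s, output s = [::], (0 < imem s 4)%N -> arrivedP s,
      (0 < imem s 5)%N -> arrivedQ s & (0 < imem s 6)%N -> on_link s].

Lemma confP : (0, 6, 7, 12, 4)%N = (0, 6, 7, 12, 4)%N \/ (0, 6, 7, 12, 4)%N = (3, 9, 8, 13, 5)%N.
Proof. by left. Qed.

Lemma confQ : (3, 9, 8, 13, 5)%N = (0, 6, 7, 12, 4)%N \/ (3, 9, 8, 13, 5)%N = (3, 9, 8, 13, 5)%N.
Proof. by right. Qed.

Lemma lettersP i : (i != i1) = (i == i0) || (i == i2).
Proof. by case: i => [[|[|[|i]]] lt]. Qed.

Lemma lettersQ i : (i != i2) = (i == i0) || (i == i1).
Proof. by case: i => [[|[|[|i]]] lt]. Qed.

Lemma to_stage1 s s' : ready s -> agree false (cells_of walkP) (regs_of walkP) s s' ->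
  ((0 < imem s' 4)%N -> arrivedP s') -> stage1 s'.
Proof.
move=> [cs o0 aP aQ [f4 f5 f6]] ag H.
have cs' := ctx_agree ag isT cs; case: ag => -[//|o] m r.
split=> //; first by rewrite o.
  by rewrite -aQ /at_reg !r.
by rewrite !m.
Qed.

Lemma to_stage2 s s' : stage1 s -> agree false (cells_of walkQ) (regs_of walkQ) s s' ->
  ((0 < imem s' 5)%N -> arrivedQ s') -> stage2 s'.
Proof.
move=> [cs o0 aQ H4 [f5 f6]] ag H.
have cs' := ctx_agree ag isT cs; case: ag => -[//|o] m r.
split=> //; [by rewrite o| |by rewrite m].
rewrite m // => /H4; apply: arrived_eq; rewrite ?m ?r //.
by rewrite /at_reg !r.
Qed.

Lemma to_stage3 s s' : stage2 s -> cagree s s' ->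
  ((0 < imem s' 6)%N -> on_link s') -> stage3 s'.
Proof.
move=> [cs o0 H4 H5 f6] ag H.
have cs' := ctx_agree ag isT cs; case: ag => -[//|o] m r.
split=> //; first by rewrite o.
  rewrite m // => /H4; apply: arrived_eq; rewrite ?m ?r //.
  by rewrite /at_reg !r.
rewrite m // => /H5; apply: arrived_eq; rewrite ?m ?r //.
by rewrite /at_reg !r.
Qed.

Definition found_all s : bool := [&& 0 < imem s 4, 0 < imem s 5 & 0 < imem s 6]%N.

Lemma finaleP s : stage3 s ->
  safe finale (fun s' => found_all s -> is_path P Q (output s')) s.
Proof.
move=> [cs o0 H4 H5 H6]; rewrite /found_all.
rewrite /finale /when.
apply: safe_if => [h4|/negbTE /= h4]; last by rewrite h4.
apply: safe_if => [h5|/negbTE /= h5]; last by rewrite h5 andbF.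
apply: safe_if => [h6|/negbTE /= h6]; last by rewrite h6 !andbF.
have := finish_cmdP charF corE LS nS MP MQ cs o0 (H4 h4) (H5 h5) (H6 h6).
by apply: safe_mono.
Qed.

Lemma main_safe s : ready s -> safe main_cmd (fun=> True) s.
Proof.
move=> rs; have [cs o0 aP aQ [f4 f5 f6]] := rs.
apply: safe_seq.
apply: safe_mono (walk_search_safe charF corE LS nS i1 i0 i2 confP NS cs aP f4) => s1 [ag1 H1].
have st1 := to_stage1 rs ag1 H1; have [cs1 _ aQ1 _ [f51 _]] := st1.
apply: safe_seq.
apply: safe_mono (walk_search_safe charF corE LS nS i2 i0 i1 confQ NS cs1 aQ1 f51) => s2 [ag2 H2].
have st2 := to_stage2 st1 ag2 H2; have [cs2 _ _ _ f62] := st2.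
apply: safe_seq.
apply: safe_mono (curve_search_safe charF corE LS NS cs2 f62) => s3 [ag3 H3].
have st3 := to_stage3 st2 ag3 H3.
by apply: safe_mono (finaleP st3).
Qed.

(** Each search contributes one factor, with the rest of the program as its continuation. Success of
    both walks supplies the maximally hyperbolic a and b for which the third estimate is assumed. *)
Lemma main_pr (p : rat) s : ready s -> 0 <= p <= 1 ->
    p <= walk_prob n i1 P -> p <= walk_prob n i2 Q ->
    (forall a b : F, max_hyp a -> max_hyp b ->
       p <= curve_prob a b * (#|F|.-1%:R / #|F|%:R)) ->
  (1 - (1 - p) ^+ N) ^+ 3 <= pr E main_cmd (fun s' => (is_path P Q (output s'))%:R) s.
Proof.
move=> rs /andP[p0 p1] pP pQ pC; have [cs o0 aP aQ [f4 f5 f6]] := rs.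
set x := 1 - (1 - p) ^+ N.
have x0 : 0 <= x.
  rewrite subr_ge0; apply: exprn_ile1; first by rewrite subr_ge0.
  by rewrite lerBlDr lerDl.
have f0 s' : 0 <= (is_path P Q (output s'))%:R :> rat by rewrite ler0n.
pose g3 := pr E finale (fun s' => (is_path P Q (output s'))%:R).
pose g2 := pr E (search (cell 3) 6 curve_trial) g3.
pose g1 := pr E (search (cell 3) 5 walkQ) g2.
have g30 s' : 0 <= g3 s' by apply: pr_ge0.
have g20 s' : 0 <= g2 s' by apply: pr_ge0.
have g10 s' : 0 <= g1 s' by apply: pr_ge0.
rewrite exprS -[pr _ _ _ s]/(pr E (search (cell 3) 4 walkP) g1 s).
apply: (walk_search_pr charF corE LS nS confP lettersP isT cs aP f4) => //.
- by rewrite p0.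
- by rewrite exprn_ge0.
move=> s1 ag1 h4 H1.
have st1 := to_stage1 rs ag1 (fun=> H1); have [cs1 _ aQ1 _ [f51 _]] := st1.
rewrite expr2.
apply: (walk_search_pr charF corE LS nS confQ lettersQ isT cs1 aQ1 f51) => //.
- by rewrite p0.
move=> s2 ag2 h5 H2.
have st2 := to_stage2 st1 ag2 (fun=> H2); have [cs2 _ _ _ f62] := st2.
have h42 : (0 < imem s2 4)%N by case: ag2 => _ m _; rewrite m.
have [_ _ H1' _ _] := st2.
rewrite -[x]mulr1.
apply: (curve_search_pr charF corE LS cs2 f62) => //.
- rewrite p0 pC //; first by case: (H1' h42).
  by case: H2.
move=> s3 ag3 h6 H3.
have st3 := to_stage3 st2 ag3 (fun=> H3).
have fa : found_all s3.
  by case: ag3 => _ m _; rewrite /found_all m // m // h42 h5 h6.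
by apply: pr_ge (finaleP st3) _ => s4 /(_ fa) ->.
Qed.

End Main.

(** * Initialization of the parameters *)

Section Prologue.

Variables (F : finFieldType) (E : env F) (c k M : nat).
Hypothesis charF : forall p : nat, p \in [pchar F] -> (5 <= p)%N.
Variables P Q : point F.

Local Open Scope nat_scope.

Definition walk_len (q : nat) := c * bits q ^ k.
Definition trials (q : nat) := 32 * M * bits q * (bits q + 2).
(** Codes of walks have [walk_len q] bits and numbers up to q have at most [bits q]; loops run
    [walk_len q], [trials q] or at most [bits q] times. *)
Definition width (q : nat) := (walk_len q + trials q + bits q).+1.

Local Notation q := #|F|.
Local Notation S := (width #|F|).

Lemma ival_ipow m e i : ival m (ipow e i) = ival m e ^ i.
Proof. by elim: i => //= i ->; rewrite expnS. Qed.

Lemma factor_block_le : all (fun v => v <= q) (factor_block q.-1).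
Proof.
have n0 := card_pred_gt0 F.
have ps : size (primes q.-1) <= q.
  apply: leq_trans (ltnW (size_primes_lt_bits n0)) _.
  by apply: leq_trans (bits_le n0) (leq_pred _).
rewrite /factor_block prime_decompE /= size_map ps /=.
apply/allP => v /flattenP[l /mapP[pe /mapP[p pp ->] ->]].
move: pp; rewrite mem_primes => /and3P[pp _ pn].
rewrite !inE => /orP[] /eqP -> /=.
  by apply: leq_trans (dvdn_leq n0 pn) (leq_pred _).
(* An exponent e in the factorization satisfies e < p^e <= q - 1. *)
have := dvdn_leq n0 (pfactor_dvdnn p q.-1) => le.
apply: leq_trans (leq_pred _); apply: leq_trans le.
by apply: ltnW; apply: ltn_expl; apply: prime_gt1.
Qed.

Lemma factor_block_prime i : i < size (primes q.-1) ->
  nth 0 (factor_block q.-1) (2 * i).+1 = nth 0 (primes q.-1) i.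
Proof.
rewrite /factor_block prime_decompE /=; elim: (primes q.-1) i => [|p l IH] [|i] // il.
by rewrite mulnS -[RHS]IH.
Qed.

Lemma size_factor_block : size (factor_block q.-1) = (2 * size (primes q.-1)).+1.
Proof.
rewrite /factor_block prime_decompE /=; congr _.+1.
by elim: (primes q.-1) => //= p l ->; rewrite mulnS.
Qed.

Lemma prologueP :
  safe E S (prologue c k M) (ready (walk_len q) (trials q) P Q) (erase (init P Q)).
Proof.
case: P Q => [[x y] z] [[x' y'] z'].
set s := erase _.
have lenS : walk_len q < S by rewrite /width ltnS -addnA leq_addr.
have triS : trials q < S by rewrite /width ltnS addnAC leq_addl.
have bitS : bits q < S by rewrite /width ltnS leq_addl.
have ev1 : ival (imem s) (IMul (IConst c) (ipow (IBits (cell 0)) k)) = walk_len q.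
  by rewrite /= ival_ipow.
apply: safe_ISet; rewrite ev1; first exact: leq_trans (bits_le_succ _) lenS.
apply: safe_ISet; first exact: leq_trans (bits_le (bits_gt0 q)) (ltnW bitS).
apply: safe_ISet; first exact: leq_trans (bits_le_succ _) triS.
set s3 := iset 3 _ _.
have fE : ival (imem s3) (ISub (cell 0) (IConst 1)) = q.-1 by rewrite /= subn1.
split; first exact: fE.
  rewrite [ival _ _]fE; apply: sub_all factor_block_le => v vq.
  exact: leq_trans (leq_bits vq) (ltnW bitS).
rewrite fE [ival _ (IConst 100)]/=; split=> //; split=> //; split.
  rewrite /imem /iblock size_factor_block (_ : 100 <= 100 < _); last by lia.
  by rewrite subnn /factor_block prime_decompE /= size_map.
move=> i il; have il2 : 2 * i.+1 <= 2 * size (primes q.-1) by rewrite leq_mul2l.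
rewrite -factor_block_prime // /iblock /imem.
rewrite (_ : 100 <= 101 + 2 * i < 100 + size (factor_block q.-1)) ?size_factor_block; last by lia.
by rewrite (_ : 101 + 2 * i - 100 = (2 * i).+1) //; lia.
Qed.

Lemma pathfinder_safe (corE : correct_env E) (MP : Mstar P) (MQ : Mstar Q) :
  safe E S (pathfinder c k M) (fun=> True) (erase (init P Q)).
Proof.
apply: safe_seq; apply: safe_mono prologueP => s rs.
by apply: (main_safe charF corE _ _ _ MP MQ rs); rewrite /width; lia.
Qed.

Lemma init_bounded : bounded S (init P Q).
Proof.
case: P Q => [[x y] z] [[x' y'] z'] a /=; case: eqP => _ //.
by rewrite /width; lia.
Qed.

End Prologue.

Lemma width_polylog c k M : polylog (width c k M).
Proof.
have pb := polylog_bits; have pc := polylog_cst.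
apply: polylog_succ; apply: (polylog_add _ pb); apply: polylog_add.
  exact: (polylog_mul (pc c) (polylog_exp k pb)).
exact: (polylog_mul (polylog_mul (pc _) pb) (polylog_add pb (pc 2))).
Qed.

(** Independent of [S], since no [Factor] or [DLog] lies inside a loop. *)
Lemma calls_pathfinder S c k M :
  factor_calls S (pathfinder c k M) = 1%N /\ dlog_calls S (pathfinder c k M) = 3%N.
Proof. by split; rewrite /= !muln0. Qed.

(** * Success probability *)

Section Numerics.

Variables (K : rat) (M : nat) (F : finFieldType).
Hypotheses (hK : 1 <= K) (KM : K <= M%:R).

Definition trial_prob : rat := (32 * M * bits #|F|)%:R^-1.

Local Notation phi := ((totient #|F|.-1)%:R : rat).
Local Notation q1 := (#|F|.-1%:R : rat).
Local Notation L := ((bits #|F|)%:R : rat).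

Lemma M_gt0 : (0 < M)%N.
Proof. by rewrite -(ltr0n rat) (lt_le_trans ltr01) // (le_trans hK). Qed.

Lemma phi_ratio : 1 <= phi / q1 * L.
Proof.
have n0 := card_pred_gt0 F.
rewrite mulrAC ler_pdivlMr ?ltr0n // mul1r -natrM ler_nat.
apply: leq_trans (totient_lower n0) _; rewrite leq_mul2l leq_bits ?orbT //.
exact: leq_pred.
Qed.

Lemma trial_probP (x y : rat) : y <= K * x -> 0 <= x -> 1 <= 32 * L * y -> trial_prob <= x.
Proof.
move=> yKx x0 Ly.
have m0 : 0 < (32 * M * bits #|F|)%:R :> rat by rewrite ltr0n !muln_gt0 M_gt0.
rewrite /trial_prob -div1r ler_pdivrMr // !natrM.
have KMx : K * x <= M%:R * x by rewrite ler_wpM2r.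
have L0 : 0 <= 32 * L by rewrite mulr_ge0.
apply: le_trans Ly _; apply: le_trans (ler_wpM2l L0 (le_trans yKx KMx)) _.
by rewrite le_eqVlt; apply/orP; left; apply/eqP; ring.
Qed.

Lemma trial_prob_walk n0 n (P : point F) j : heuristicA K n0 P -> (n0 <= n)%N ->
  trial_prob <= walk_prob n j P.
Proof.
move=> hA nn; have /andP[h _] := hA n j nn; apply: trial_probP h _ _.
  by rewrite divr_ge0.
by have := phi_ratio; rewrite !mulrA; lra.
Qed.

(** The constant 32 arises here as 8 * 2 * 2: besides the 1/8 of Heuristic B, a factor (q - 1) / q
    >= 1/2 is lost for drawing t from all of F_q, and another in passing from phi / (q - 1) to phi /
    q. *)
Lemma trial_prob_curve (a b : F) : heuristicB K F -> max_hyp a -> max_hyp b ->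
  trial_prob <= curve_prob a b * (q1 / #|F|%:R).
Proof.
move=> hB ha hb; have /andP[h _] := hB a b ha hb.
have n0 := card_pred_gt0 F; have q0 : 0 < #|F|%:R :> rat.
  by rewrite ltr0n (leq_trans n0) // leq_pred.
have half : 2^-1 <= q1 / #|F|%:R.
  rewrite ler_pdivlMr // ler_pdivrMl // -natrM ler_nat; lia.
set rho := q1 / _ in half *.
have rho0 : 0 <= rho by apply: le_trans half.
have h' := ler_wpM2r rho0 h; rewrite -[leRHS]mulrA in h'.
apply: trial_probP h' _ _.
  by rewrite mulr_ge0 // divr_ge0.
have e : phi / #|F|%:R = phi / q1 * rho.
  by rewrite /rho; field; rewrite gt_eqF // pnatr_eq0 -lt0n.
rewrite e; have := phi_ratio; move: (phi / q1) => R RL.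
have r2 : 4^-1 <= rho * rho by nra.
have : 4^-1 * 1 <= (rho * rho) * (R * L) by apply: ler_pM.
lra.
Qed.

Lemma trial_prob_bounds : 0 <= trial_prob <= 1.
Proof.
rewrite /trial_prob invr_ge0 ler0n invf_le1 ?ler1n ?ltr0n !muln_gt0 M_gt0 //.
Qed.

(** With [bits q + 2] halvings a search fails with probability d <= 1 / (4q), as q < 2^(bits q); and
    (1 - d)^3 >= 1 - 3d. *)
Lemma success_prob : 1 - #|F|%:R^-1 <= (1 - (1 - trial_prob) ^+ trials M #|F|) ^+ 3.
Proof.
have /andP[p0 p1] := trial_prob_bounds.
have m0 : (32 * M * bits #|F|)%:R != 0 :> rat by rewrite pnatr_eq0 -lt0n !muln_gt0 M_gt0.
have := @fail_prob_le trial_prob (32 * M * bits #|F|) (bits #|F| + 2) trial_prob_bounds.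
rewrite /trial_prob divff // => /(_ (lexx _)); rewrite -/trial_prob -/(trials M #|F|).
set d := (_ ^+ trials _ _); move=> dle.
have d0 : 0 <= d by rewrite exprn_ge0 // subr_ge0.
have q0 : 0 < #|F|%:R :> rat.
  by rewrite ltr0n (leq_trans (card_pred_gt0 F)) // leq_pred.
have d4 : 4 * d <= #|F|%:R^-1.
  have : 2 ^- (bits #|F| + 2) <= (4 * #|F|%:R)^-1 :> rat.
    rewrite lef_pV2 ?posrE ?mulr_gt0 ?exprn_gt0 // exprD mulrC.
    rewrite (_ : 2 ^+ 2 = 4) // ler_pM2r // -natrX ler_nat.
    exact: ltnW (ltn_bits _).
  rewrite invfM => /(le_trans dle); lra.
have d1 : d <= 1 by apply: exprn_ile1; rewrite ?subr_ge0 // lerBlDr lerDl.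
apply: (@le_trans _ _ (1 - 3 * d)); first by lra.
rewrite !exprS expr0 mulr1; nra.
Qed.

End Numerics.

Theorem theorem1p1 (K : rat) (n0 : nat -> nat) (hK : 1 <= K)
    (hn0 : polylog n0) :
  exists PATHFINDER : cmd,
  forall OP : nat -> nat, polylog OP ->
  exists2 NEGLIGIBLE : nat -> nat, polylog NEGLIGIBLE &
  forall (FACTOR DLP : nat -> nat) (F : finFieldType) (E : env F)
         (P Q : point F),
    (forall p : nat, p \in [pchar F] -> (5 <= p)%N) ->
    correct_env E ->
    time_op E = OP -> time_factor E = FACTOR -> time_dlog E = DLP ->
    Mstar P -> Mstar Q ->
    heuristicA K (n0 #|F|) P -> heuristicA K (n0 #|F|) Q ->
    heuristicB K F ->
    let PATH := (FACTOR #|F|.-1 + 3 * DLP #|F| + NEGLIGIBLE #|F|)%N in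
    1 - #|F|%:R^-1 <= prob E PATHFINDER (finds_path P Q PATH) (init P Q).
Proof.
have [c [k n0le]] := hn0.
(* [K] is rational, but the program text can contain natural numbers only. *)
pose M := Num.bound K.
have KM : K <= M%:R by apply/ltW/archi_boundP/(le_trans ler01).
exists (pathfinder c k M) => OP pOP.
(* [ctime] leaves out the time inside [Factor] and [DLog]; all the rest is polylogarithmic. *)
exists (fun q => ctime (width c k M q) (OP q) (pathfinder c k M)).
  exact: polylog_ctime (width_polylog c k M) pOP _.
move=> FACTOR DLP F E P Q charF corE eOP eF eD MP MQ hAP hAQ hB; cbv zeta.
set S := width c k M #|F|.
rewrite (@prob_safe _ _ S) //; first last.
- rewrite (_ : clock (init P Q) = 0%N); last by case: (P) (Q) => [[? ?] ?] [[? ?] ?].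
  have [f1 d3] := calls_pathfinder S c k M.
  by rewrite /clock_bound f1 d3 eOP eF eD -/S; lia.
- exact: pathfinder_safe.
- exact: init_bounded.
apply: le_trans (success_prob F hK KM) _.
have nle : (n0 #|F| <= walk_len c k #|F|)%N by apply: n0le.
have H := prologueP E c k M P Q.
rewrite -[pr _ _ _ _]/(pr E (prologue c k M) (pr E main_cmd
  (fun s' => (is_path P Q (output s'))%:R)) (erase (init P Q))).
apply: (pr_ge H) => s rs.
apply: (main_pr (S := S) charF corE _ _ MP MQ rs).
- by rewrite /S /width; lia.
- by rewrite /S /width; lia.
- exact: (trial_prob_bounds F hK KM).
- exact: (trial_prob_walk hK KM _ hAP nle).
- exact: (trial_prob_walk hK KM _ hAQ nle).
- by move=> a b ha hb; apply: (trial_prob_curve hK KM hB).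
Qed.
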